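(* Let $h\in\mathbb{R}[x_1,\ldots,x_n]$ be hyperbolic with respect to $\mathbf{e}\in\mathbb{R}^n$, let $V_1,\ldots,V_m$ be finite sets of vectors in $\Lambda_+(\mathbf{e})$, and let $\mathbf{w}\in\mathbb{R}^{n+m}$. For $\mathbf{V}=(\mathbf{v}_1,\ldots,\mathbf{v}_m)\in V_1\times\cdots\times V_m$ let $f(\mathbf{V};t):=h[\mathbf{v}_1,\ldots,\mathbf{v}_m](t\mathbf{e}+\mathbf{w})$, where $t\mathbf{e}$ denotes $(t\mathbf{e},0,\ldots,0)\in\mathbb{R}^{n+m}$. Then $\{f(\mathbf{V};t)\}_{\mathbf{V}\in V_1\times\cdots\times V_m}$ is a compatible family. In particular, if in addition all vectors in $V_1\cup\cdots\cup V_m$ have rank at most one, and $g(\mathbf{V};t):=h(t\mathbf{e}+\mathbf{w}-\alpha_1\mathbf{v}_1-\cdots-\alpha_m\mathbf{v}_m)$ where $\mathbf{w}\in\mathbb{R}^n$ and $(\alpha_1,\ldots,\alpha_m)\in\mathbb{R}^m$, then $\{g(\mathbf{V};t)\}_{\mathbf{V}\in V_1\times\cdots\times V_m}$ is a compatible family.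
   Context: A homogeneous polynomial $h$ of degree $d$ is hyperbolic with respect to $\mathbf{e}\in\mathbb{R}^n$ if $h(\mathbf{e})\neq0$ and for every $\mathbf{x}\in\mathbb{R}^n$, $t\mapsto h(t\mathbf{e}-\mathbf{x})$ has only real zeros; writing $h(t\mathbf{e}-\mathbf{x})=h(\mathbf{e})\prod_{j=1}^d(t-\lambda_j(\mathbf{x}))$ defines the eigenvalues. $\Lambda_+(\mathbf{e})=\{\mathbf{x}:\min_j\lambda_j(\mathbf{x})\geq0\}$, and $\operatorname{rk}(\mathbf{x})=\#\{j:\lambda_j(\mathbf{x})\neq0\}$. For $\mathbf{v}\in\mathbb{R}^n$, $D_{\mathbf{v}}=\sum_k v_k\partial/\partial x_k$, and $h[\mathbf{v}_1,\ldots,\mathbf{v}_m]:=\prod_{j=1}^m(1-y_jD_{\mathbf{v}_j})\,h(\mathbf{x})\in\mathbb{R}[x_1,\ldots,x_n,y_1,\ldots,y_m]$, viewed as a function on $\mathbb{R}^{n+m}=\mathbb{R}^n\oplus\mathbb{R}^m$. Compatible family: given finite sets $S_1,\ldots,S_m$, a family $\{f(\mathbf{s};t)\}_{\mathbf{s}\in S_1\times\cdots\times S_m}$ of real univariate polynomials in $t$, all of whose non-zero members have the same degree and the same sign of leading coefficient, is compatible if for all choices of independent random variables $\mathsf{X}_1\in S_1,\ldots,\mathsf{X}_m\in S_m$ the polynomial $\mathbb{E}f(\mathsf{X}_1,\ldots,\mathsf{X}_m;t)$ is real-rooted. *)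

(* Defs.v *)
From HB Require Import structures.
From mathcomp Require Import all_boot all_order all_algebra.
From mathcomp Require Import finmap.
From mathcomp Require Import mpoly.

Set Implicit Arguments.
Unset Strict Implicit.
Unset Printing Implicit Defensive.

Import Order.TTheory GRing.Theory Num.Theory.
Local Open Scope ring_scope.

Section HyperbolicDefs.
Variable R : rcfType.

(* A univariate polynomial "has only real zeros": it splits into real
   linear factors.  (The zero polynomial counts as real-rooted.) *)
Definition real_rooted (p : {poly R}) : Prop :=
  exists rs : seq R, p = lead_coef p *: \prod_(r <- rs) ('X - r%:P).

Definition hline_plus (n : nat) (h : {mpoly R[n]}) (e : 'rV[R]_n)
  (u : 'I_n -> R) : {poly R} :=
  mmap polyC (fun i => e 0 i *: 'X + (u i)%:P) h.

Definition hline (n : nat) (h : {mpoly R[n]}) (e x : 'rV[R]_n) : {poly R} :=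
  mmap polyC (fun i => e 0 i *: 'X - (x 0 i)%:P) h.

(* h is hyperbolic with respect to e (h is assumed homogeneous separately) *)
Definition hyperbolic (n : nat) (h : {mpoly R[n]}) (e : 'rV[R]_n) : Prop :=
  h.@[fun i => e 0 i] != 0 /\ forall x : 'rV[R]_n, real_rooted (hline h e x).

Definition eigenvalues (n : nat) (h : {mpoly R[n]}) (e x : 'rV[R]_n)
  (rs : seq R) : Prop :=
  hline h e x = h.@[fun i => e 0 i] *: \prod_(r <- rs) ('X - r%:P).

Definition in_Lambda_plus (n : nat) (h : {mpoly R[n]}) (e x : 'rV[R]_n) : Prop :=
  exists rs, eigenvalues h e x rs /\ all (fun r => 0 <= r) rs.

Definition rank_of (n : nat) (h : {mpoly R[n]}) (e x : 'rV[R]_n) (k : nat) : Prop :=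
  exists rs, eigenvalues h e x rs /\ count (fun r => r != 0) rs = k.

Definition Dder (k : nat) (v : 'I_k -> R) (p : {mpoly R[k]}) : {mpoly R[k]} :=
  \sum_(i < k) v i *: mderiv i p.

Definition extv (n m : nat) (v : 'rV[R]_n) : 'I_(n + m) -> R :=
  fun k => match split k with inl i => v 0 i | inr _ => 0 end.

Definition hlift (n m : nat) (h : {mpoly R[n]}) : {mpoly R[n + m]} :=
  mmap (fun c => c%:MP) (fun i : 'I_n => 'X_(lshift m i)) h.

(* h[v_1,...,v_m] = prod_j (1 - y_j D_{v_j}) h *)
Definition hbracket (n m : nat) (h : {mpoly R[n]}) (vs : 'I_m -> 'rV[R]_n)
  : {mpoly R[n + m]} :=
  foldr (fun j q => q - 'X_(rshift n j) * Dder (@extv n m (vs j)) q)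
        (@hlift n m h) (enum 'I_m).

Definition evalNM_line (n m : nat) (P : {mpoly R[n + m]}) (e : 'rV[R]_n)
  (w : 'rV[R]_(n + m)) : {poly R} :=
  mmap polyC (fun k => match split k with
                       | inl i => e 0 i *: 'X + (w 0 k)%:P
                       | inr _ => (w 0 k)%:P end) P.

Definition compatible (m : nat) (S : 'I_m -> finType)
  (f : (forall i, S i) -> {poly R}) : Prop :=
  (forall s s' : forall i, S i, f s != 0 -> f s' != 0 ->
     size (f s) = size (f s') /\
     Num.sg (lead_coef (f s)) = Num.sg (lead_coef (f s'))) /\
  (forall p : forall i, S i -> R,
     (forall i x, 0 <= p i x) -> (forall i, \sum_(x : S i) p i x = 1) ->
     real_rooted (\sum_(s : {dffun forall i, S i})
                    (\prod_(i < m) p i (s i)) *: f s)).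

End HyperbolicDefs.

(* Main.v *)
Require Import Defs.
From HB Require Import structures.
From mathcomp Require Import all_boot all_order all_algebra.
From mathcomp Require Import finmap.
From mathcomp Require Import mpoly.
From mathcomp Require Import complex ring lra.
Import Order.TTheory GRing.Theory Num.Theory.
Local Open Scope ring_scope.

(** A directional derivative along a vector of the hyperbolicity cone sends each
    product of operators to another polynomial with the same top form, so the
    expectation of the family is again a product of such operators, with [D_v]
    replaced by the average [\sum_v p(v) D_v].  It thus suffices that one averaged
    operator [1 - y \sum_v p(v) D_v] preserves real-rootedness along [e] for every
    (not necessarily homogeneous) [F] with top form [h].  This holds because
    [Im (D_v F / F) <= 0] on [x + z e] with [Im z > 0], for each [v] separately; no
    convexity of the cone is needed.

    To avoid continuity of roots, which is awkward over a real closed field, this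
    last inequality is proved algebraically.  If all restrictions of [F] to lines
    along [e] have simple roots and [h(t e + v)] has positive coefficients, the
    polynomials [s |-> (D_e^j F)(x + s v)] interlace successively: Laguerre's
    inequality gives [D_e^(j-1) F * D_e^(j+1) F < 0] wherever [D_e^j F] vanishes, as in a
    Sturm chain.  Hence [D_v F * D_e F > 0] on the zeros of [F], which is the
    positivity of the residues of [D_v F / F].  Replacing [F] by [F - t D_e F], which
    lowers root multiplicities, and [v] by [v + t e] reduces the general case to
    this one.

    If [v] has rank at most one, then [D_v h] is real-rooted along [e] and its top
    form has rank zero in the direction [v], which forces [D_v D_v h = 0]; so
    [h(x - a v) = (h - a D_v h)(x)] and the second family is an instance of the first. *)

Set Implicit Arguments.
Unset Strict Implicit.
Unset Printing Implicit Defensive.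

(** * Real polynomials evaluated in the upper half-plane *)

Section ComplexEvaluation.
Variable R : rcfType.
Implicit Types (p q f g : {poly R}) (z : R[i]) (rs : seq R).
Local Notation Re := (@complex.Re R).
Local Notation Im := (@complex.Im R).

Definition cev p z : R[i] := (map_poly (real_complex R) p).[z].

Lemma cevD p q z : cev (p + q) z = cev p z + cev q z.
Proof. by rewrite /cev rmorphD hornerD. Qed.

Lemma cevM p q z : cev (p * q) z = cev p z * cev q z.
Proof. by rewrite /cev rmorphM hornerM. Qed.

Lemma cevZ a p z : cev (a *: p) z = a%:C%C * cev p z.
Proof. by rewrite /cev map_polyZ hornerZ. Qed.

Lemma cevXsubC a z : cev ('X - a%:P) z = z - a%:C%C.
Proof. by rewrite /cev rmorphB /= map_polyX map_polyC hornerXsubC. Qed.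

(* [Im (p(z) * conj (q(z)))], which has the sign of [Im (p(z) / q(z))]. *)
Definition imJ p q z : R :=
  Im (cev p z) * Re (cev q z) - Re (cev p z) * Im (cev q z).

Definition csqr z : R := Re z ^+ 2 + Im z ^+ 2.

Lemma csqr_ge0 z : 0 <= csqr z.
Proof. by rewrite addr_ge0 ?sqr_ge0. Qed.

Lemma csqr_gt0 z : (0 < csqr z) = (z != 0).
Proof.
rewrite lt_neqAle csqr_ge0 andbT eq_sym /csqr.
case: z => a b /=; rewrite paddr_eq0 ?sqr_ge0 // !sqrf_eq0.
by rewrite eq_complex.
Qed.

Lemma csqrM z1 z2 : csqr (z1 * z2) = csqr z1 * csqr z2.
Proof. by case: z1 => a b; case: z2 => c d; rewrite /csqr /=; ring. Qed.

Lemma imJpp p z : imJ p p z = 0.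
Proof. by rewrite /imJ; ring. Qed.

Lemma imJC p q z : imJ p q z = - imJ q p z.
Proof. by rewrite /imJ; ring. Qed.

Lemma imJDl p q f z : imJ (p + q) f z = imJ p f z + imJ q f z.
Proof.
rewrite /imJ cevD; case: (cev p z) => a b; case: (cev q z) => c d /=; ring.
Qed.

Lemma imJZl a p f z : imJ (a *: p) f z = a * imJ p f z.
Proof. rewrite /imJ cevZ; case: (cev p z) => c b /=; ring. Qed.

Lemma imJDr p q f z : imJ f (p + q) z = imJ f p z + imJ f q z.
Proof. by rewrite imJC imJDl opprD -!imJC. Qed.

Lemma imJZr a p f z : imJ f (a *: p) z = a * imJ f p z.
Proof. by rewrite imJC imJZl -mulrN -imJC. Qed.

Lemma imJNl p f z : imJ (- p) f z = - imJ p f z.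
Proof. by rewrite -scaleN1r imJZl mulN1r. Qed.

(** In quotients this is [(p + (X - b) f) / ((X - b) q) = p / ((X - b) q) + f / q], with
    denominators cleared by [csqr]. It is the induction step for adding one root to a
    denominator. *)
Lemma imJ_XsubC b p q f z :
  imJ (p + ('X - b%:P) * f) (('X - b%:P) * q) z =
  imJ p (('X - b%:P) * q) z + csqr (z - b%:C%C) * imJ f q z.
Proof.
rewrite imJDl /imJ /csqr !cevM !cevXsubC.
case: (cev f z) => a1 a2; case: (cev q z) => b1 b2; case: z => x y /=; ring.
Qed.

Lemma imJ_selfXsubC b q z :
  imJ q (('X - b%:P) * q) z = - (Im z * csqr (cev q z)).
Proof.
rewrite /imJ /csqr cevM cevXsubC.
case: (cev q z) => b1 b2; case: z => x y /=; ring.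
Qed.

Lemma imJ_linear_mul al ga q z :
  imJ ((al *: 'X + ga%:P) * q) q z = al * Im z * csqr (cev q z).
Proof.
rewrite /imJ /csqr cevM cevD cevZ /cev map_polyX map_polyC hornerX hornerC.
case: (_.[z]) => b1 b2; case: z => x y /=; ring.
Qed.

Lemma cev_prod_neq0 rs z : Im z != 0 ->
  cev (\prod_(r <- rs) ('X - r%:P)) z != 0.
Proof.
move=> hz; elim: rs => [|r rs IH].
  by rewrite big_nil /cev rmorph1 hornerC oner_eq0.
rewrite big_cons cevM mulf_neq0 // cevXsubC.
by apply: contraNneq hz => /eqP; rewrite subr_eq0 => /eqP -> /=; rewrite eqxx.
Qed.

Lemma real_rooted_cev_neq0 p z :
  real_rooted p -> p != 0 -> Im z != 0 -> cev p z != 0.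
Proof.
move=> [rs ->] p0 hz; rewrite cevZ mulf_neq0 ?cev_prod_neq0 //.
rewrite fmorph_eq0; apply: contraNneq p0 => ->; by rewrite scale0r.
Qed.

Lemma cev_conj p z : cev p z^*%C = (cev p z)^*%C.
Proof.
rewrite {1}/cev.
have -> : map_poly (real_complex R) p =
    map_poly conjc (map_poly (real_complex R) p).
  by rewrite -map_poly_comp; apply: eq_map_poly => a; rewrite /= oppr0.
by rewrite horner_map.
Qed.

(** [R[i]] is algebraically closed, so a nonconstant [p] has a root there. Conjugation moves a root
    in the lower half-plane to the upper one, so the root is real and can be divided out. *)
Lemma cev_neq0_real_rooted p :
  (forall z, 0 < Im z -> cev p z != 0) -> real_rooted p.
Proof.
move: {2}(size p) (leqnn (size p)) => k.
elim: k p => [|k IH] p hs hp.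
  by exists [::]; move: hs; rewrite leqn0 size_poly_eq0 => /eqP ->; rewrite lead_coef0 scale0r.
have [s1|s1] := leqP (size p) 1.
  exists [::]; rewrite big_nil; rewrite (size1_polyC s1) lead_coefC.
  by rewrite alg_polyC.
have [|z] := closed_rootP (map_poly (real_complex R) p) _.
  by rewrite size_map_poly gtn_eqF.
rewrite rootE => /eqP rz.
have iz : Im z = 0.
  apply/eqP; case: (ltrgtP (Im z) 0) => // h.
    have := hp (z^*)%C; rewrite cev_conj /cev rz conjc0 eqxx.
    by case: z h {rz} => x y /= h; rewrite oppr_gt0 => /(_ h).
  by have := hp z h; rewrite /cev rz eqxx.
have rx : root p (Re z).
  move: rz; have -> : z = (Re z)%:C%C by case: z iz => x y /= ->.
  by rewrite horner_map /= rootE => -[->].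
move: (rx) => /factor_theorem [q pq].
have q0 : q != 0 by apply: contraTneq s1 => q0; rewrite pq q0 mul0r size_poly0.
have [||rs qE] := IH q.
- move: hs; rewrite pq size_Mmonic ?monicXsubC // size_XsubC addn2 /=.
  by rewrite ltnS.
- move=> w hw; have := hp w hw; rewrite pq cevM.
  by apply: contra => /eqP ->; rewrite mul0r.
exists (Re z :: rs); rewrite big_cons pq lead_coef_Mmonic ?monicXsubC //.
by rewrite {1}qE -scalerAl mulrC.
Qed.

End ComplexEvaluation.

(** * Laguerre's inequality, root multiplicities, interlacing and limits *)

Section RealRootedPolynomials.
Variable R : rcfType.
Implicit Types (p q f g k : {poly R}) (z : R[i]) (rs : seq R) (a b c x : R).
Local Notation Re := (@complex.Re R).
Local Notation Im := (@complex.Im R).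
Local Notation rprod rs := (\prod_(r <- rs) ('X - r%:P) : {poly R}).

Lemma real_rootedP p : p != 0 -> real_rooted p ->
  exists c rs, [/\ c != 0, p = c *: rprod rs & size p = (size rs).+1].
Proof.
move=> p0 [rs pE]; exists (lead_coef p), rs.
have c0 : lead_coef p != 0 by rewrite lead_coef_eq0.
split=> //; rewrite {1}pE size_scale // size_prod_XsubC.
by [].
Qed.

Lemma real_rootedZ c p : real_rooted p -> real_rooted (c *: p).
Proof. by move=> [rs E]; exists rs; rewrite lead_coefZ -scalerA -E. Qed.

Lemma deriv_XsubC_mul r q :
  (('X - r%:P) * q)^`() = q + ('X - r%:P) * q^`().
Proof. by rewrite derivM derivXsubC mul1r. Qed.

(** [p' / p] is the sum of the [1 / (z - r)], each with negative imaginary part. *)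
Lemma imJ_deriv_prod_le0 rs z : 0 < Im z ->
  imJ (rprod rs)^`() (rprod rs) z <= 0.
Proof.
move=> hz; elim: rs => [|r rs IH].
  rewrite big_nil derivC /imJ /cev map_poly0 horner0 /=; lra.
rewrite big_cons deriv_XsubC_mul imJ_XsubC imJ_selfXsubC.
have h1 : csqr (z - r%:C%C) * imJ (rprod rs)^`() (rprod rs) z <= 0.
  by rewrite mulr_ge0_le0 ?csqr_ge0.
have h2 : 0 <= Im z * csqr (cev (rprod rs) z).
  by rewrite mulr_ge0 ?csqr_ge0 // ltW.
lra.
Qed.

Lemma imJ_deriv_lt0 p z : real_rooted p -> (1 < size p)%N -> 0 < Im z ->
  imJ p^`() p z < 0.
Proof.
move=> rp sp hz.
have p0 : p != 0 by apply: contraTneq sp => ->; rewrite size_poly0.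
have [c [[|r rs] [c0 pE sE]]] := real_rootedP p0 rp; first by rewrite sE in sp.
rewrite pE derivZ imJZl imJZr mulrA -expr2.
rewrite pmulr_rlt0 ?exprn_even_gt0 //.
rewrite big_cons deriv_XsubC_mul imJ_XsubC imJ_selfXsubC.
have h1 : csqr (z - r%:C%C) * imJ (rprod rs)^`() (rprod rs) z <= 0.
  by rewrite mulr_ge0_le0 ?csqr_ge0 ?imJ_deriv_prod_le0.
have h2 : 0 < Im z * csqr (cev (rprod rs) z).
  by rewrite mulr_gt0 // csqr_gt0 cev_prod_neq0 // gt_eqF.
lra.
Qed.

(** Equals [- p^2 (p' / p)']; for a product of factors [X - r] it is the sum of the squares of the
    products omitting one factor. *)
Definition laguerre p x := p^`().[x] ^+ 2 - p.[x] * p^`()^`().[x].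

Lemma laguerre_XsubC r q x :
  laguerre (('X - r%:P) * q) x = q.[x] ^+ 2 + (x - r) ^+ 2 * laguerre q x.
Proof.
rewrite /laguerre deriv_XsubC_mul derivD deriv_XsubC_mul.
by rewrite !(hornerD, hornerM, hornerN, hornerX, hornerC); ring.
Qed.

Lemma laguerre_prod_ge0 rs x : 0 <= laguerre (rprod rs) x.
Proof.
elim: rs => [|r rs IH]; last first.
  by rewrite big_cons laguerre_XsubC addr_ge0 ?sqr_ge0 // mulr_ge0 ?sqr_ge0.
by rewrite big_nil /laguerre derivC deriv0 !horner0 mulr0 expr2 mulr0 subr0.
Qed.

Lemma laguerre_gt0 p x : real_rooted p -> (1 < size p)%N ->
  p.[x] != 0 \/ p^`().[x] != 0 -> 0 < laguerre p x.
Proof.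
move=> rp sp.
have p0 : p != 0 by apply: contraTneq sp => ->; rewrite size_poly0.
have [px|px] := eqVneq p.[x] 0 => hx.
  by case: hx => // p'x; rewrite /laguerre px mul0r subr0 exprn_even_gt0.
have [c [[|r rs] [c0 pE sE]]] := real_rootedP p0 rp; first by rewrite sE in sp.
have -> : laguerre p x = c ^+ 2 * laguerre (rprod (r :: rs)) x.
  by rewrite pE /laguerre !derivZ !hornerZ; ring.
apply: mulr_gt0; first by rewrite exprn_even_gt0.
rewrite big_cons laguerre_XsubC ltr_pwDl //.
  rewrite exprn_even_gt0 //=; apply: contra_neq px => h.
  by rewrite pE big_cons hornerZ hornerM h !mulr0.
by rewrite mulr_ge0 ?sqr_ge0 ?laguerre_prod_ge0.
Qed.

Lemma real_rooted_deriv p : real_rooted p -> real_rooted p^`().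
Proof.
move=> rp; have [s1|s1] := leqP (size p) 1.
  by rewrite (size1_polyC s1) derivC; exists [::]; rewrite lead_coef0 scale0r.
apply: cev_neq0_real_rooted => z /(imJ_deriv_lt0 rp s1) h.
by apply: contraTneq h => h; rewrite /imJ h /= !mul0r subrr ltxx.
Qed.

(** Bounds by [n] the multiplicity of every root in [R]; [n = 1] means simple roots. *)
Definition order_le (n : nat) p := forall x, exists2 i, (i <= n)%N & p^`(i).[x] != 0.

Lemma order_le1P p : order_le 1 p <-> forall x, p.[x] = 0 -> p^`().[x] != 0.
Proof.
split=> [h x px|h x]; last first.
  have [px|px] := eqVneq p.[x] 0; last by exists 0%N; rewrite ?derivn0.
  by exists 1%N; rewrite ?derivn1 ?h.
by have [[|[|i]] //] := h x; rewrite derivn0 px eqxx.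
Qed.

Lemma order_le1_deriv p : real_rooted p -> (1 < size p)%N -> order_le 1 p ->
  order_le 1 p^`().
Proof.
move=> rp sp /order_le1P op; apply/order_le1P => x h1.
have h : p.[x] != 0 by apply/eqP => /op; rewrite h1 eqxx.
have := laguerre_gt0 rp sp (or_introl h).
by rewrite /laguerre h1 expr0n /= sub0r oppr_gt0; apply: contraTneq => ->; rewrite mulr0 ltxx.
Qed.

(** At a nonreal zero, [p = a p'] would make [imJ] of [p'] and [p] vanish, while it is strictly
    negative. *)
Lemma real_rooted_sub_deriv p a : real_rooted p -> real_rooted (p - a *: p^`()).
Proof.
move=> rp; have [s1|s1] := leqP (size p) 1.
  by rewrite {2}(size1_polyC s1) derivC scaler0 subr0.
apply: cev_neq0_real_rooted => z hz; apply/eqP => h.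
have hn := imJ_deriv_lt0 rp s1 hz.
have h0 : imJ (p - a *: p^`()) p^`() z = 0 by rewrite /imJ h /= !mul0r subrr.
move: h0; rewrite imJDl imJNl imJZl imJpp imJC; lra.
Qed.

(** If the derivatives of [p - a p'] up to order [n + 1] vanish at [x], then [p^(i) = a p^(i+1)]
    there. The cases [i = 0, 1] make the Laguerre expression zero, which forces [p(x) = 0]; then all
    derivatives of [p] up to order [n + 2] vanish in turn. *)
Lemma order_le_sub_deriv n p a : real_rooted p -> (1 < size p)%N -> a != 0 ->
  order_le n.+2 p -> order_le n.+1 (p - a *: p^`()).
Proof.
move=> rp sp a0 op x.
have dE i : (p - a *: p^`())^`(i).[x] = p^`(i).[x] - a * p^`(i.+1).[x].
  by rewrite derivnB derivnZ -derivSn hornerD hornerN hornerZ.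
case: (boolP [exists i : 'I_n.+2, (p - a *: p^`())^`(i).[x] != 0]).
  by move=> /existsP[i hi]; exists i; rewrite // -ltnS.
rewrite negb_exists => /forallP h; exfalso.
have {}h i : (i < n.+2)%N -> p^`(i).[x] = a * p^`(i.+1).[x].
  move=> hi; have := h (Ordinal hi); rewrite negbK dE subr_eq0 => /eqP; exact.
have p0 : p.[x] = 0.
  apply/eqP/negPn/negP => hp.
  have := laguerre_gt0 rp sp (or_introl hp).
  have := h 0%N isT; have := h 1%N isT; rewrite /laguerre derivn0 derivn1 !derivSn derivn0.
  by move=> -> ->; rewrite (_ : _ - _ = 0) ?ltxx //; ring.
have pi0 i : (i <= n.+2)%N -> p^`(i).[x] = 0.
  elim: i => [|i IH] hi; first by rewrite derivn0.
  have := IH (ltnW hi); rewrite h // => /eqP; rewrite mulf_eq0 (negPf a0) /=.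
  by move/eqP.
by have [i /pi0 ->] := op x; rewrite eqxx.
Qed.

(** With [q] the product over [rs], the hypothesis says that the residues [f(b) / q'(b)] are
    nonnegative. So [f / q] is a nonnegative combination of the [1 / (X - b)]: it has nonpositive
    imaginary part in the upper half-plane and nonpositive derivative on the line. *)
Lemma partial_fraction_signs f rs : uniq rs -> (size f <= size rs)%N ->
  (forall b, b \in rs -> 0 <= f.[b] * (rprod rs)^`().[b]) ->
  (forall z, 0 < Im z -> imJ f (rprod rs) z <= 0) /\
  (forall x, 0 <= (rprod rs)^`().[x] * f.[x] - (rprod rs).[x] * f^`().[x]).
Proof.
elim: rs f => [|r rs IH] f.
  rewrite leqn0 size_poly_eq0 => _ /eqP -> _; split=> [z _|x].
    by rewrite /imJ /cev map_poly0 horner0 /= !mul0r subrr.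
  by rewrite deriv0 !horner0 !mulr0 subrr.
rewrite /= => /andP[rn urs] sf hf.
set q := rprod rs in IH *; have qE : rprod (r :: rs) = ('X - r%:P) * q by rewrite big_cons.
have qr : q.[r] != 0 by rewrite -rootE root_prod_XsubC.
(* [w] is the residue at [r]; what remains after removing [w / (X - r)] is [f1 / q]. *)
pose w := f.[r] / q.[r].
have /factor_theorem[f1] : root (f - w *: q) r.
  by rewrite rootE hornerD hornerN hornerZ divfK // subrr.
rewrite mulrC => /eqP; rewrite subr_eq addrC => /eqP fE.
have sq : size q = (size rs).+1 by rewrite size_prod_XsubC.
have sf1 : (size f1 <= size rs)%N.
  have : (size (f - w *: q)%R <= (size rs).+1)%N.
    rewrite (leq_trans (size_polyD _ _)) // geq_max sf size_polyN.
    by rewrite (leq_trans (size_scale_leq _ _)) // sq.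
  have -> : f - w *: q = ('X - r%:P) * f1 by rewrite fE [X in X - _]addrC addrK.
  have [->|f10] := eqVneq f1 0; first by rewrite size_poly0.
  by rewrite size_monicM ?monicXsubC // size_XsubC.
have w0 : 0 <= w.
  have := hf r; rewrite mem_head qE deriv_XsubC_mul hornerD hornerM.
  rewrite hornerXsubC subrr mul0r addr0 => /(_ isT) h.
  rewrite /w -(mulr1 f.[r]) -(mulfV qr) mulrA -mulrA -expr2.
  by rewrite mulr_ge0 // exprn_even_ge0.
have [|I1 I2] := IH f1 urs sf1.
  move=> b hb; have bq : q.[b] = 0 by apply/eqP; rewrite -rootE root_prod_XsubC.
  have br : b - r != 0 by rewrite subr_eq0; apply: contraNneq rn => <-.
  have := hf b; rewrite inE hb orbT => /(_ isT).
  rewrite fE qE deriv_XsubC_mul !hornerD !hornerM !hornerXsubC hornerZ bq.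
  rewrite mulr0 !add0r mulrACA -expr2 pmulr_rge0 ?exprn_even_gt0 //.
rewrite qE; split=> [z hz|x].
  rewrite fE imJ_XsubC imJZl imJ_selfXsubC.
  have h1 : csqr (z - r%:C%C) * imJ f1 q z <= 0.
    by apply: mulr_ge0_le0; [exact: csqr_ge0 | exact: I1].
  have h2 : 0 <= w * (Im z * csqr (cev q z)).
    by apply: mulr_ge0 => //; apply: mulr_ge0; [exact: ltW | exact: csqr_ge0].
  by rewrite mulrN; lra.
have -> : (('X - r%:P) * q)^`().[x] * f.[x] - (('X - r%:P) * q).[x] * f^`().[x] =
   w * q.[x] ^+ 2 + (x - r) ^+ 2 * (q^`().[x] * f1.[x] - q.[x] * f1^`().[x]).
  rewrite fE !(derivD, derivZ, deriv_XsubC_mul).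
  rewrite !(hornerD, hornerM, hornerZ, hornerN, hornerX, hornerC).
  by ring.
by rewrite addr_ge0 // mulr_ge0 ?sqr_ge0.
Qed.

Lemma simple_roots_uniq c rs : order_le 1 (c *: rprod rs) -> uniq rs.
Proof.
move=> /order_le1P h; elim: rs h => //= r rs IH h.
apply/andP; split.
  apply/negP => rin; have qr : (rprod rs).[r] = 0.
    by apply/eqP; rewrite -rootE root_prod_XsubC.
  have := h r; rewrite big_cons derivZ !hornerZ deriv_XsubC_mul hornerD !hornerM.
  by rewrite hornerXsubC subrr !mul0r qr addr0 mulr0 eqxx => /(_ erefl).
apply: IH => x; rewrite hornerZ => qx.
have := h x; rewrite big_cons derivZ !hornerZ deriv_XsubC_mul hornerD !hornerM.
rewrite mulrCA qx mulr0 => /(_ erefl); apply: contra_neq.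
rewrite derivZ hornerZ => h'.
have c0 : c != 0.
  by apply/eqP => c0; move: (h x); rewrite c0 scale0r deriv0 !horner0 eqxx => /(_ erefl).
move/eqP: qx; rewrite mulf_eq0 (negPf c0) /= => /eqP ->.
by rewrite add0r mulrCA h' mulr0.
Qed.

(** One step of a Sturm chain [f, g, k]. On the zeros of [g] the sign of [k] is that of [g'], so
    [f / g] is an increasing linear function plus a combination of the [1 / (X - b)] with negative
    residues. Hence [f / g] maps the upper half-plane to itself and has positive derivative, which
    gives both conclusions. *)
Lemma real_rooted_interlace_step (D : nat) f g k :
  real_rooted g -> (size g <= D.+1)%N -> 0 < g`_D ->
  (size f <= D.+2)%N -> 0 < f`_D.+1 ->
  (forall b, g.[b] = 0 -> 0 < g^`().[b] * k.[b]) ->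
  (forall b, g.[b] = 0 -> f.[b] * k.[b] < 0) ->
  real_rooted f /\ forall x, f.[x] = 0 -> 0 < f^`().[x] * g.[x].
Proof.
move=> rg sg gD sf fD gk fk.
have g0 : g != 0 by apply: contraTneq gD => ->; rewrite coef0 ltxx.
have sgE : size g = D.+1.
  by apply/eqP; rewrite eqn_leq sg /= ltnNge; apply: contraL gD => h; rewrite nth_default ?ltxx.
have [c [rs [c0 gE srs]]] := real_rootedP g0 rg.
have sD : size rs = D by apply: succn_inj; rewrite -srs.
have urs : uniq rs.
  apply: (@simple_roots_uniq c); rewrite -gE; apply/order_le1P => x /gk.
  by apply: contraTneq => ->; rewrite mul0r ltxx.
(* Division of [f] by [g]: quotient [al X + ga], remainder [rho]. *)
pose al := f`_D.+1 / g`_D; have al0 : 0 < al by rewrite divr_gt0.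
pose f1 := f - al *: ('X * g); pose ga := f1`_D / g`_D.
pose rho := f1 - ga *: g.
have fE : f = (al *: 'X + ga%:P) * g + rho.
  by rewrite /rho /f1 mulrDl -scalerAl mul_polyC; ring.
have sf1 : (size f1 <= D.+1)%N.
  apply/leq_sizeP => j; rewrite leq_eqVlt => /orP[/eqP <-|hj].
    by rewrite coefB coefZ coefXM /= divfK ?subrr // gt_eqF.
  rewrite coefB coefZ coefXM; case: j hj => // j hj /=.
  by rewrite !nth_default ?mulr0 ?subrr ?sgE // (leq_trans sf).
have srho : (size rho <= size rs)%N.
  rewrite sD; apply/leq_sizeP => j; rewrite leq_eqVlt => /orP[/eqP <-|hj].
    by rewrite coefB coefZ divfK ?subrr // gt_eqF.
  by rewrite coefB coefZ !nth_default ?mulr0 ?subrr ?sgE // (leq_trans sf1).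
have gb b : b \in rs -> g.[b] = 0.
  by rewrite -root_prod_XsubC gE hornerZ => /eqP ->; rewrite mulr0.
have [||PF1 PF2] := @partial_fraction_signs ((- c) *: rho) rs urs.
- by rewrite (leq_trans (size_scale_leq _ _)).
- move=> b /gb hb; have := gk b hb; have := fk b hb.
  rewrite fE hornerD hornerM hb mulr0 add0r gE derivZ !hornerZ.
  set u := rho.[b]; set v := (rprod rs)^`().[b] => h1 h2.
  (* Multiplication by [k(b)^2] reduces the sign to that of [- (rho(b) k(b)) (g'(b) k(b))], where
     [rho(b) = f(b)]. *)
  have k0 : 0 < k.[b] ^+ 2.
    by rewrite exprn_even_gt0 //=; apply: contraTneq h1 => ->; rewrite mulr0 ltxx.
  rewrite -(pmulr_rge0 _ k0) (_ : _ * _ = - ((u * k.[b]) * (c * v * k.[b]))); last by ring.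
  by rewrite oppr_ge0 nmulr_rle0 // ltW.
have hIm z : 0 < Im z -> 0 < imJ f g z.
  move=> hz; rewrite fE imJDl imJ_linear_mul.
  have h1 : 0 < al * Im z * csqr (cev g z).
    apply: mulr_gt0; first exact: mulr_gt0.
    by rewrite csqr_gt0 (real_rooted_cev_neq0 rg) // gt_eqF.
  have := PF1 z hz; rewrite imJZl mulNr oppr_le0.
  have -> : c * imJ rho (rprod rs) z = imJ rho g z by rewrite gE imJZr.
  lra.
split.
  apply: cev_neq0_real_rooted => z /hIm; apply: contraTneq => h.
  by rewrite /imJ h /= !mul0r subrr ltxx.
move=> x fx.
have gx : g.[x] != 0 by apply/eqP => h; have := fk x h; rewrite fx mul0r ltxx.
have -> : f^`().[x] * g.[x] = f^`().[x] * g.[x] - f.[x] * g^`().[x].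
  by rewrite fx mul0r subr0.
have -> : f^`().[x] * g.[x] - f.[x] * g^`().[x] =
  al * g.[x] ^+ 2 + (rho^`().[x] * g.[x] - rho.[x] * g^`().[x]).
  rewrite fE !(derivD, derivM, derivZ, derivX, derivC).
  rewrite !(hornerD, hornerM, hornerZ, hornerX, hornerC).
  by ring.
apply: ltr_pwDl; first by apply: mulr_gt0; rewrite // exprn_even_gt0.
have := PF2 x; rewrite derivZ !hornerZ gE derivZ !hornerZ.
rewrite (_ : _ - _ = rho^`().[x] * (c * (rprod rs).[x])
  - rho.[x] * (c * (rprod rs)^`().[x])) //; ring.
Qed.

Lemma csqr_cev_prod_ge rs z :
  (Im z ^+ 2) ^+ size rs <= csqr (cev (rprod rs) z).
Proof.
elim: rs => [|r rs IH].
  by rewrite big_nil /cev rmorph1 hornerC /csqr /=; lra.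
rewrite big_cons cevM csqrM [size _]/= exprS.
apply: ler_pM; [exact: sqr_ge0 | exact/exprn_ge0/sqr_ge0 | | exact: IH].
by rewrite cevXsubC /csqr; case: z {IH} => x y /=; rewrite subr0 lerDr sqr_ge0.
Qed.

(** If [p(z) = 0] with [Im z > 0], then [p + e q] has squared modulus [e^2 |q(z)|^2] at [z]. Being
    real-rooted, it is also bounded below there by its squared leading coefficient times a power of
    [Im z]. The sign hypothesis keeps that coefficient from shrinking, so a small [e] is
    contradictory. *)
Lemma real_rooted_limit p q : (size q <= size p)%N ->
  0 <= lead_coef p * q`_(size p).-1 ->
  (forall e, 0 < e -> real_rooted (p + e *: q)) -> real_rooted p.
Proof.
move=> sq hlc hrr.
have [->|p0] := eqVneq p 0; first by exists [::]; rewrite lead_coef0 scale0r.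
apply: cev_neq0_real_rooted => z hz; apply/eqP => pz.
pose m := (size p).-1; pose K := lead_coef p ^+ 2 * (Im z ^+ 2) ^+ m.
have K0 : 0 < K.
  apply: mulr_gt0; first by rewrite exprn_even_gt0 // lead_coef_eq0.
  exact/exprn_gt0/exprn_gt0.
pose C := csqr (cev q z); have C0 : 0 <= C by exact: csqr_ge0.
have key e : 0 < e -> K <= e ^+ 2 * C.
  move=> e0; set P := p + e *: q.
  have hm : P`_m = lead_coef p + e * q`_m by rewrite coefD coefZ.
  have hsq : lead_coef p ^+ 2 <= P`_m ^+ 2.
    rewrite hm sqrrD -addrA lerDl addr_ge0 ?sqr_ge0 //.
    by rewrite mulrn_wge0 // mulrCA mulr_ge0 // ltW.
  have Pm : P`_m != 0.
    by rewrite -sqrf_eq0 gt_eqF // (lt_le_trans _ hsq) ?exprn_even_gt0 ?lead_coef_eq0.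
  have sP : size P = m.+1.
    apply/eqP; rewrite eqn_leq; apply/andP; split; last first.
      by rewrite ltnNge; apply: contra_neqN Pm => h; rewrite nth_default.
    rewrite /m prednK ?size_poly_gt0 // (leq_trans (size_polyD _ _)) // geq_max leqnn /=.
    by rewrite (leq_trans (size_scale_leq _ _)).
  have Pn0 : P != 0 by rewrite -size_poly_eq0 sP.
  have [rs] := hrr e e0; rewrite -/P => PE.
  have lP : lead_coef P = P`_m by rewrite lead_coefE sP.
  have srs : size rs = m.
    apply: succn_inj; rewrite -sP PE size_scale ?lead_coef_eq0 //.
    by rewrite size_prod_XsubC.
  have -> : e ^+ 2 * C = csqr (cev P z).
    by rewrite cevD cevZ pz add0r csqrM /C /csqr /= expr0n addr0.
  rewrite PE cevZ csqrM; apply: ler_pM; [exact: sqr_ge0 | exact/exprn_ge0/sqr_ge0 | |].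
    by rewrite /csqr /= expr0n addr0 lP.
  by rewrite -srs csqr_cev_prod_ge.
(* Chosen so that [e <= 1] and [e C < K], hence [e^2 C < K]. *)
pose e := K / (K + C + 1).
have d0 : 0 < K + C + 1 by lra.
have e0 : 0 < e by rewrite divr_gt0.
have e1 : e <= 1 by rewrite ler_pdivrMr //; lra.
have := key e e0.
have h1 : e ^+ 2 * C <= e * C by rewrite ler_wpM2r // expr2 ler_piMl // ltW.
have h2 : e * C < K.
  by rewrite /e mulrAC ltr_pdivrMr // ltr_pM2l //; lra.
lra.
Qed.

End RealRootedPolynomials.

(** * Directional derivatives, restrictions to lines and top forms *)

Section DirectionalDerivative.
Variables (R : rcfType) (n : nat).
Implicit Types (F G h : {mpoly R[n]}) (u v x : 'I_n -> R) (c t : R).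

(** Reduces identities between morphisms and derivations to constants and variables. *)
Lemma mpoly_ring_ind (P : {mpoly R[n]} -> Prop) :
  (forall c, P c%:MP) -> (forall i, P 'X_i) ->
  (forall F G, P F -> P G -> P (F + G)) ->
  (forall F G, P F -> P G -> P (F * G)) -> forall F, P F.
Proof.
move=> hC hX hD hM; elim/mpolyind => [|c m F _ _ IH]; first by rewrite -mpolyC0.
apply: (hD) => //; rewrite -mul_mpolyC; apply: (hM) => //.
rewrite mpolyXE_id; apply: big_ind => [||i _]; [exact: hC | exact: hM |].
by elim: (m i) => [|k]; rewrite ?expr0 ?exprS; [move=> *; exact: hC | exact: hM].
Qed.

Lemma DderD v F G : Dder v (F + G) = Dder v F + Dder v G.
Proof. by rewrite /Dder -big_split; apply: eq_bigr => i _; rewrite mderivD scalerDr. Qed.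

Lemma DderZ v c F : Dder v (c *: F) = c *: Dder v F.
Proof.
rewrite /Dder scaler_sumr; apply: eq_bigr => i _.
by rewrite mderivZ !scalerA mulrC.
Qed.

Lemma DderB v F G : Dder v (F - G) = Dder v F - Dder v G.
Proof. by rewrite DderD -scaleN1r DderZ scaleN1r. Qed.

Lemma DderM v F G : Dder v (F * G) = Dder v F * G + F * Dder v G.
Proof.
rewrite /Dder mulr_suml mulr_sumr -big_split; apply: eq_bigr => i _.
by rewrite mderivM scalerDr scalerAl scalerAr.
Qed.

Lemma DderC v c : Dder v c%:MP = 0.
Proof. by rewrite /Dder big1 // => i _; rewrite mderivC scaler0. Qed.

Lemma DderX v i : Dder v 'X_i = (v i)%:MP.
Proof.
rewrite /Dder (bigD1 i) //= big1 => [|j ji]; rewrite mderivX mnm1E ?eqxx.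
  by rewrite scale1r -{1}[U_(i)%MM]add0m addmK mpolyX0 addr0 -mul_mpolyC mulr1.
by rewrite eq_sym (negPf ji) scale0r scaler0.
Qed.

Lemma Dder_dirD u v c F : Dder (fun i => u i + c * v i) F = Dder u F + c *: Dder v F.
Proof.
rewrite /Dder scaler_sumr -big_split; apply: eq_bigr => i _.
by rewrite scalerDl scalerA.
Qed.

Lemma msize_leP F k :
  reflect (forall m, (k <= mdeg m)%N -> F@_m = 0) (msize F <= k)%N.
Proof.
apply: (iffP idP) => [h m km|h].
  by apply/eqP; rewrite mcoeff_eq0 msize_mdeg_ge // (leq_trans h).
rewrite msizeE; apply/bigmax_leqP_seq => m mF _; rewrite ltnNge.
by apply: contraL mF => /h /eqP; rewrite mcoeff_eq0.
Qed.

Lemma msize_DderS v F k : (msize F <= k.+1)%N -> (msize (Dder v F) <= k)%N.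
Proof.
move=> /msize_leP h; apply/msize_leP => m km; rewrite raddf_sum big1 //= => i _.
by rewrite mcoeffZ mcoeff_mderiv h ?mul0rn ?mulr0 // mdegD mdeg1 addn1.
Qed.

Lemma msizeD_leq F G k : (msize F <= k)%N -> (msize G <= k)%N -> (msize (F + G) <= k)%N.
Proof.
move=> /msize_leP hF /msize_leP hG; apply/msize_leP => m km.
by rewrite mcoeffD hF ?hG ?addr0.
Qed.

Lemma msizeZ_leq c F k : (msize F <= k)%N -> (msize (c *: F) <= k)%N.
Proof. exact/leq_trans/msizeZ_le. Qed.

Lemma dhomog_Dder v h d : h \is d.-homog -> Dder v h \is d.-1.-homog.
Proof.
move=> hh; apply/dhomogP => m; rewrite mcoeff_msupp; apply: contraNeq => hm.
rewrite raddf_sum big1 //= => i _; rewrite mcoeffZ mcoeff_mderiv.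
rewrite (dhomog_nemf_coeff hh) ?mul0rn ?mulr0 //=.
by apply: contra hm => /eqP <-; rewrite mdegD mdeg1 addn1.
Qed.

Lemma dhomog_msize_leq h d : h \is d.-homog -> (msize h <= d.+1)%N.
Proof.
move=> hh; apply/msize_leP => m dm.
by rewrite (dhomog_nemf_coeff hh) //= gtn_eqF.
Qed.

Definition line F x v : {poly R} := mmap polyC (fun i => v i *: 'X + (x i)%:P) F.

Lemma lineD F G x v : line (F + G) x v = line F x v + line G x v.
Proof. exact: mmapD. Qed.

Lemma lineZ c F x v : line (c *: F) x v = c *: line F x v.
Proof. by rewrite /line mmapZ mul_polyC. Qed.

Lemma lineB F G x v : line (F - G) x v = line F x v - line G x v.
Proof. exact: mmapB. Qed.

Lemma lineM F G x v : line (F * G) x v = line F x v * line G x v.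
Proof. exact: rmorphM. Qed.

Lemma lineC c x v : line c%:MP x v = c%:P.
Proof. exact: mmapC. Qed.

Lemma lineX i x v : line 'X_i x v = v i *: 'X + (x i)%:P.
Proof. by rewrite /line mmapX mmap1U. Qed.

Lemma horner_line F x v t : (line F x v).[t] = F.@[fun i => x i + t * v i].
Proof.
elim/mpoly_ring_ind: F => [c|i|F G IF IG|F G IF IG].
- by rewrite lineC hornerC mevalC.
- by rewrite lineX mevalXU hornerD hornerZ hornerX hornerC addrC mulrC.
- by rewrite lineD hornerD mevalD IF IG.
- by rewrite lineM hornerM mevalM IF IG.
Qed.

Lemma deriv_line F x v : (line F x v)^`() = line (Dder v F) x v.
Proof.
elim/mpoly_ring_ind: F => [c|i|F G IF IG|F G IF IG].
- by rewrite DderC -mpolyC0 !lineC derivC.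
- by rewrite DderX lineX lineC derivD derivZ derivX derivC addr0 alg_polyC.
- by rewrite DderD !lineD derivD IF IG.
- by rewrite DderM lineD !lineM derivM IF IG.
Qed.

Lemma line_monomial (m : 'X_{1..n}) x v :
  (size (line 'X_[m] x v) <= (mdeg m).+1)%N /\
  (line 'X_[m] x v)`_(mdeg m) = \prod_i v i ^+ m i.
Proof.
rewrite mdegE /line mmapX /mmap1.
elim/big_rec3: _ => [|i a k q _ [sq qk]].
  by rewrite size_poly1 coef1.
(* The degree bounds need not be attained, as some [v i] may be zero, so coefficients at the bounds
   replace leading coefficients. *)
have aux (p : {poly R}) j1 (r : {poly R}) j2 : (size p <= j1.+1)%N -> (size r <= j2.+1)%N ->
    (size (p * r)%R <= (j1 + j2).+1)%N /\ (p * r)`_(j1 + j2) = p`_j1 * r`_j2.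
  move=> sp sr; split.
    apply: leq_trans (size_polyMleq _ _) _.
    by rewrite -subn1 leq_subLR add1n (leq_trans (leq_add sp sr)) // addSn addnS.
  rewrite coefM (bigD1 (inord j1)) //= inordK ?ltnS ?leq_addr // addKn.
  rewrite big1 ?addr0 // => l; rewrite -val_eqE /= inordK ?ltnS ?leq_addr // => nl.
  case: (ltngtP l j1) nl => // hl _.
    by rewrite [r`__]nth_default ?mulr0 // (leq_trans sr) // ltn_subRL ltn_add2r.
  by rewrite [p`__]nth_default ?mul0r // (leq_trans sp).
have s1 : (size (v i *: 'X + (x i)%:P : {poly R})%R <= 2)%N.
  apply/leq_sizeP => j hj; rewrite coefD coefZ coefX coefC.
  by case: j hj => [|[|j]] // _; rewrite mulr0 addr0.
have s2 : (v i *: 'X + (x i)%:P : {poly R})`_1 = v i.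
  by rewrite coefD coefZ coefX coefC mulr1 addr0.
have [sl cl] : (size ((v i *: 'X + (x i)%:P) ^+ m i : {poly R})%R <= (m i).+1)%N /\
    ((v i *: 'X + (x i)%:P) ^+ m i : {poly R})`_(m i) = v i ^+ m i.
  elim: (m i) => [|j [IH1 IH2]]; first by rewrite !expr0 size_poly1 coef1.
  rewrite !exprS -add1n; have [? ->] := aux _ 1%N _ j s1 IH1.
  by rewrite s2 IH2.
have [? ->] := aux _ (m i) _ _ sl sq.
by rewrite cl qk.
Qed.

Lemma line_sum F x v : line F x v = \sum_(m <- msupp F) F@_m *: line 'X_[m] x v.
Proof.
rewrite {1}(mpolyE F) /line raddf_sum /=; apply: eq_bigr => m _.
by rewrite mmapZ mul_polyC.
Qed.

Lemma size_line F x v k : (msize F <= k)%N -> (size (line F x v) <= k)%N.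
Proof.
move=> hF; rewrite line_sum; apply: (leq_trans (size_sum _ _ _)).
apply/bigmax_leqP_seq => m mF _; apply: leq_trans (size_scale_leq _ _) _.
apply: leq_trans (line_monomial m x v).1 _.
exact: leq_trans (msize_mdeg_lt mF) hF.
Qed.

Lemma coef_line_dhomog h d x v : h \is d.-homog -> (line h x v)`_d = h.@[v].
Proof.
move=> /dhomogP hh; rewrite line_sum coef_sum mevalE.
rewrite !big_seq; apply: eq_bigr => m mh; rewrite coefZ; congr (_ * _).
by rewrite -(hh m mh) (line_monomial m x v).2.
Qed.

(** [msize] is the degree plus one, so [F - h] has degree below [d]. Keeping [h] explicit lets it
    stay fixed while operators [1 - y D_v] change [F]. *)
Definition has_top d F h := h \is d.-homog /\ (msize (F - h)%R <= d)%N.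

Lemma has_top_refl d h : h \is d.-homog -> has_top d h h.
Proof. by move=> hh; split; rewrite // subrr msize0. Qed.

Lemma has_top_msize d F h : has_top d F h -> (msize F <= d.+1)%N.
Proof.
move=> [hh hs]; rewrite -(subrK h F) msizeD_leq //.
  exact: leqW.
exact: dhomog_msize_leq.
Qed.

Lemma has_top_Dder d v F h : has_top d.+1 F h -> has_top d (Dder v F) (Dder v h).
Proof.
move=> [hh hs]; split; first exact: dhomog_Dder hh.
by rewrite -DderB msize_DderS.
Qed.

Lemma has_topD d F h G : has_top d F h -> (msize G <= d)%N -> has_top d (F + G) h.
Proof.
by move=> [hh hs] hG; split; rewrite // addrAC msizeD_leq.
Qed.

Lemma has_top_Dder_msize d v F h : has_top d F h -> (msize (Dder v F) <= d)%N.
Proof. by move/has_top_msize/msize_DderS. Qed.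

Lemma size_line_top d F h x v : has_top d F h -> (size (line F x v) <= d.+1)%N.
Proof. by move/has_top_msize/size_line. Qed.

Lemma coef_line_top d F h x v : has_top d F h -> (line F x v)`_d = h.@[v].
Proof.
move=> [hh hs]; rewrite -(subrK h F) lineD coefD (coef_line_dhomog _ _ hh).
by rewrite nth_default ?add0r // size_line.
Qed.

Lemma size_line_topE d F h x v : has_top d F h -> h.@[v] != 0 ->
  size (line F x v) = d.+1.
Proof.
move=> ht hv; apply/eqP; rewrite eqn_leq (size_line_top _ _ ht) ltnNge.
by apply: contra_neqN hv => hs; rewrite -(coef_line_top x v ht) nth_default.
Qed.

End DirectionalDerivative.

(** * Polynomial identities from infinitely many points, and elementary estimates *)

Section PolynomialTools.
Variable R : rcfType.
Implicit Types (p q : {poly R}).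

Lemma poly_eq0_inj (K : idomainType) (p : {poly K}) (f : nat -> K) :
  injective f -> (forall k, p.[f k] = 0) -> p = 0.
Proof.
move=> fI hf; apply/eqP; apply: contraT => p0.
have := @max_poly_roots _ p [seq f k | k <- iota 0 (size p)] p0.
rewrite map_inj_uniq // iota_uniq size_map size_iota ltnn; apply=> //.
by apply/allP => _ /mapP[k _ ->]; rewrite rootE hf.
Qed.

Lemma poly_ext_pos p q : (forall t, 0 < t -> p.[t] = q.[t]) -> p = q.
Proof.
move=> h; apply/eqP; rewrite -subr_eq0; apply/eqP.
apply: (@poly_eq0_inj _ _ (fun k => k.+1%:R)) => [a b /eqP|k].
  by rewrite eqr_nat => /eqP[].
by rewrite hornerD hornerN h ?ltr0Sn // subrr.
Qed.

Lemma cev_eq0 p : (forall z, 0 < complex.Im z -> cev p z = 0) -> p = 0.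
Proof.
move=> h; apply/eqP; rewrite -(map_poly_eq0 (real_complex R)); apply/eqP.
apply: (@poly_eq0_inj _ _ (fun k => Complex k%:R 1)) => [a b [/eqP]|k].
  by rewrite eqr_nat => /eqP.
by apply: h => /=; exact: ltr01.
Qed.

Lemma real_rooted_size1 p : (size p <= 1)%N -> real_rooted p.
Proof.
move=> /size1_polyC ->; exists [::].
by rewrite big_nil lead_coefC alg_polyC.
Qed.

Lemma order_le_size d p : size p = d.+1 -> order_le d p.
Proof.
move=> sp x; exists d => //.
have -> : p^`(d) = (p`_d *+ d ^_ d)%:P.
  apply/polyP => i; rewrite coef_derivn coefC; case: i => [|i] /=; first by rewrite addn0.
  by rewrite nth_default ?mul0rn // sp addnS ltnS leq_addr.
rewrite hornerC mulrn_eq0 negb_or ffactnn -lt0n fact_gt0 /=.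
by have := lead_coef_eq0 p; rewrite lead_coefE sp -size_poly_eq0 sp => ->.
Qed.

Lemma coef_prod_neg_roots_gt0 (rs : seq R) j : all (fun r => r < 0) rs ->
  (j <= size rs)%N -> 0 < (\prod_(r <- rs) ('X - r%:P))`_j.
Proof.
elim: rs j => [|r rs IH] j /=.
  by rewrite leqn0 => _ /eqP ->; rewrite big_nil coef1.
case/andP=> r0 rs0; rewrite big_cons mulrBl coefB coefXM coefCM.
set q := \prod_(_ <- _) _ in IH *.
have q0 i : 0 <= q`_i.
  have [hi|hi] := leqP i (size rs); first exact/ltW/IH.
  by rewrite nth_default // /q size_prod_XsubC.
case: j => [_|j hj] /=; first by rewrite sub0r oppr_gt0 nmulr_rlt0 ?IH.
by rewrite ltr_wpDr ?IH // -mulNr mulr_ge0 // oppr_ge0 ltW.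
Qed.

(** Stands for the limit as [t] decreases to 0: [imJ] of two polynomials affine in [t] is quadratic
    in [t]. *)
Lemma quadratic_le0_limit (a b c : R) :
  (forall t, 0 < t -> a + t * b + t ^+ 2 * c <= 0) -> a <= 0.
Proof.
move=> h; rewrite leNgt; apply/negP => a0.
have nb := ler_norm (- b); have nc := ler_norm (- c); rewrite !normrN in nb nc.
have b0 := normr_ge0 b; have c0 := normr_ge0 c.
set B := `|b| in nb b0; set C := `|c| in nc c0.
pose t := a / (a + B + C + 1).
have d0 : 0 < a + B + C + 1 by lra.
have t0 : 0 < t by rewrite divr_gt0.
have t1 : t <= 1 by rewrite ler_pdivrMr //; lra.
have := h t t0.
have h1 : t * (a + B + C + 1) = a by rewrite divfK ?gt_eqF.
have h2 : t ^+ 2 * (- c) <= t * C.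
  apply: (@le_trans _ _ (t ^+ 2 * C)); first by rewrite ler_wpM2l ?sqr_ge0.
  by rewrite ler_wpM2r // expr2 ler_piMl // ltW.
have h3 : t * (- b) <= t * B by rewrite ler_wpM2l // ltW.
have h4 : 0 < t * (a + 1) by apply: mulr_gt0 => //; lra.
lra.
Qed.

End PolynomialTools.

(** * Derivatives along the cone preserve real-rootedness *)

Section Cone.
Variables (R : rcfType) (n : nat).
Implicit Types (F G h : {mpoly R[n]}) (e u v x : 'I_n -> R).
Local Notation Im := (@complex.Im R).

Lemma meval_dhomogZ h d (s : R) x : h \is d.-homog ->
  h.@[fun i => s * x i] = s ^+ d * h.@[x].
Proof.
move=> /dhomogP hh; rewrite !mevalE big_distrr /= !big_seq.
apply: eq_bigr => m mh; rewrite mulrCA; congr (_ * _).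
under eq_bigr do rewrite exprMn.
by rewrite big_split /= prodrXr -mdegE; rewrite (hh m mh).
Qed.

Lemma horner_line_shift F x v e (b : R) :
  (line F (fun i => x i + b * v i) e).[0] = (line F x v).[b].
Proof. by rewrite !horner_line; apply: meval_eq => i; rewrite mul0r addr0. Qed.

Lemma horner_line0 F x v : (line F x v).[0] = F.@[x].
Proof. by rewrite horner_line; apply: meval_eq => i; rewrite mul0r addr0. Qed.

(** Induction along the chain [F, D_e F, D_e^2 F] restricted to the direction [v]. The induction
    hypothesis for [D_e F] supplies one sign condition of the interlacing step, Laguerre's
    inequality the other. *)
Lemma strict_monotone d e v F h :
  has_top d F h -> (forall j, (j <= d)%N -> 0 < (line h v e)`_j) ->
  (forall x, real_rooted (line F x e)) -> (forall x, order_le 1 (line F x e)) ->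
  forall x, real_rooted (line F x v) /\
    forall t, (line F x v).[t] = 0 ->
      0 < (line (Dder v F) x v).[t] * (line (Dder e F) x v).[t].
Proof.
elim: d F h => [|d IH] F h ht hpos hrr hs x.
all: have hv : 0 < h.@[v] by rewrite -(horner_line0 h v e) horner_coef0 hpos.
  have sF := size_line_top x v ht; split; first exact: real_rooted_size1.
  move=> t; rewrite (size1_polyC sF) hornerC (coef_line_top _ _ ht) => h0.
  by rewrite h0 ltxx in hv.
have he : 0 < h.@[e] by rewrite -(coef_line_dhomog v e ht.1) hpos.
have sF y : size (line F y e) = d.+2 by apply: (size_line_topE _ ht); rewrite gt_eqF.
have ht' := has_top_Dder e ht.
have [||| rg gk] := IH (Dder e F) (Dder e h) ht' _ _ _ x.
- by move=> j hj; rewrite -deriv_line coef_deriv pmulrn_lgt0 // hpos.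
- by move=> y; rewrite -deriv_line; apply: real_rooted_deriv.
- by move=> y; rewrite -deriv_line; apply: order_le1_deriv; rewrite ?sF.
have [||||||rf fg] := @real_rooted_interlace_step R d (line F x v)
  (line (Dder e F) x v) (line (Dder e (Dder e F)) x v) rg.
- exact: size_line_top ht'.
- rewrite (coef_line_top _ _ ht') -(horner_line0 _ v e) horner_coef0.
  by rewrite -deriv_line coef_deriv pmulrn_lgt0 // hpos.
- exact: size_line_top ht.
- by rewrite (coef_line_top _ _ ht).
- by move=> b /gk; rewrite deriv_line.
(* Laguerre's inequality is used on the line along [e] through the point [x + b v], at parameter
   0. *)
- move=> b gb; have op := (order_le1P _).1 (hs (fun i => x i + b * v i)) 0.
  have := @laguerre_gt0 R (line F (fun i => x i + b * v i) e) 0 (hrr _).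
  rewrite sF /laguerre => /(_ isT); rewrite !deriv_line !horner_line_shift gb.
  rewrite expr0n /= sub0r oppr_gt0; apply; left.
  move: op; rewrite deriv_line !horner_line_shift gb eqxx.
  by move=> op; apply/eqP => /op.
split=> // t /fg; by rewrite deriv_line.
Qed.

(** On the line along [e], the residue of [D_v F / F] at a zero is the value of [D_v F / D_e F]
    there; its sign comes from [strict_monotone] with that zero as base point. *)
Lemma imJ_line_strict d e v F h :
  has_top d F h -> (forall j, (j <= d)%N -> 0 < (line h v e)`_j) ->
  (forall x, real_rooted (line F x e)) -> (forall x, order_le 1 (line F x e)) ->
  forall x z, 0 < Im z -> imJ (line (Dder v F) x e) (line F x e) z <= 0.
Proof.
move=> ht hpos hrr hs x z hz.
have he : 0 < h.@[e] by rewrite -(coef_line_dhomog v e ht.1) hpos.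
have sF : size (line F x e) = d.+1 by apply: (size_line_topE _ ht); rewrite gt_eqF.
have p0 : line F x e != 0 by rewrite -size_poly_eq0 sF.
have [c [rs [c0 pE srs]]] := real_rootedP p0 (hrr x).
have urs : uniq rs by apply: (@simple_roots_uniq _ c); rewrite -pE.
have sD : size rs = d by apply: succn_inj; rewrite -srs.
have [||PF _] := @partial_fraction_signs R (c *: line (Dder v F) x e) rs urs.
- rewrite sD (leq_trans (size_scale_leq _ _)) // size_line //.
  exact: has_top_Dder_msize ht.
- move=> b hb; rewrite hornerZ.
  have -> : (\prod_(r <- rs) ('X - r%:P))^`().[b] = c^-1 * (line (Dder e F) x e).[b].
    by rewrite -deriv_line pE derivZ hornerZ mulKf.
  rewrite mulrACA mulfV // mul1r; apply: ltW.
  have [_ /(_ 0)] := strict_monotone ht hpos hrr hs (fun i => x i + b * e i).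
  rewrite !horner_line0 => h0; rewrite !horner_line; apply: h0; rewrite -horner_line pE hornerZ.
  by move: hb; rewrite -root_prod_XsubC rootE => /eqP ->; rewrite mulr0.
by rewrite pE imJZr -imJZl; apply: PF.
Qed.

(** Induction on a bound for the multiplicities. [F - t D_e F] keeps the top form and lowers the
    bound by one; the inequality for it is quadratic in [t], and its constant term is the wanted
    quantity. *)
Lemma imJ_line_pos_coef d e v F h :
  has_top d F h -> (forall j, (j <= d)%N -> 0 < (line h v e)`_j) ->
  (forall x, real_rooted (line F x e)) ->
  forall x z, 0 < Im z -> imJ (line (Dder v F) x e) (line F x e) z <= 0.
Proof.
move=> ht hpos hrr.
have he : 0 < h.@[e] by rewrite -(coef_line_dhomog v e ht.1) hpos.
have szE (G : {mpoly R[n]}) (y : 'I_n -> R) : has_top d G h -> size (line G y e) = d.+1.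
  by move=> hG; apply: (size_line_topE _ hG); rewrite gt_eqF.
case: (posnP d) => [d0|d0].
  apply: (imJ_line_strict ht hpos hrr) => y z.
  have [i i0 hi] := order_le_size (szE F y ht) z.
  by exists i => //; rewrite (leq_trans i0) // d0.
have : forall x, order_le d.-1.+1 (line F x e).
  by move=> y; rewrite prednK //; apply: order_le_size; apply: szE.
move: (d.-1) => k; elim: k F ht hrr => [|k IH] F ht hrr ho x z hz.
  exact: imJ_line_strict ht hpos hrr ho _ _ hz.
set A := line (Dder v F) x e; set p := line F x e.
pose B := line (Dder v (Dder e F)) x e.
apply: (@quadratic_le0_limit _ _ (- (imJ A p^`() z + imJ B p z)) (imJ B p^`() z)) => t t0.
have lE y : line (F - t *: Dder e F) y e = line F y e - t *: (line F y e)^`().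
  by rewrite lineB lineZ deriv_line.
have ht' : has_top d (F - t *: Dder e F) h.
  rewrite -scaleNr; apply: has_topD => //; apply: msizeZ_leq.
  exact: has_top_Dder_msize ht.
have hrr' y : real_rooted (line (F - t *: Dder e F) y e).
  by rewrite lE; apply: real_rooted_sub_deriv.
have ho' y : order_le k.+1 (line (F - t *: Dder e F) y e).
  rewrite lE; apply: order_le_sub_deriv => //; last by rewrite gt_eqF.
  by rewrite szE // ltnS.
have := IH _ ht' hrr' ho' x z hz.
rewrite lE DderB DderZ lineB lineZ -/A -/B -/p.
rewrite -!scaleNr !imJDl !imJZl !imJDr !imJZr => IH'.
by apply: le_trans IH'; rewrite le_eqVlt; apply/orP; left; apply/eqP; ring.
Qed.

(** The line here is [h(v + t e)], not [h(t e - v)], so its roots are the negated eigenvalues. *)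
Definition in_cone h e v :=
  exists2 rs, all (fun r => r <= 0) rs & line h v e = h.@[e] *: \prod_(r <- rs) ('X - r%:P).

(** Replacing [v] by [v + t e] shifts the roots of [h(v + s e)] by [- t]; they become strictly
    negative, so all coefficients are positive. The added term is linear in [t] and disappears in
    the limit. *)
Lemma imJ_line_cone_pos d e v F h :
  has_top d F h -> 0 < h.@[e] -> in_cone h e v ->
  (forall x, real_rooted (line F x e)) ->
  forall x z, 0 < Im z -> imJ (line (Dder v F) x e) (line F x e) z <= 0.
Proof.
move=> ht he [rs rs0 hE] hrr x z hz.
set A := line _ _ _; set p := line _ _ _.
apply: (@quadratic_le0_limit _ _ (imJ p^`() p z) 0) => t t0.
rewrite mulr0 addr0.
have := @imJ_line_pos_coef d e (fun i => v i + t * e i) F h ht _ hrr x z hz.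
rewrite Dder_dirD lineD lineZ -deriv_line -/A -/p imJDl imJZl; apply.
move=> j hj.
have -> : line h (fun i => v i + t * e i) e =
    h.@[e] *: \prod_(r <- [seq r - t | r <- rs]) ('X - r%:P).
  apply: poly_ext_pos => s _; rewrite horner_line.
  rewrite (_ : _.@[_] = (line h v e).[s + t]); last first.
    by rewrite horner_line; apply: meval_eq => i; ring.
  rewrite hE !hornerZ big_map !horner_prod; congr (_ * _).
  by apply: eq_bigr => r _; rewrite !hornerXsubC; ring.
have srs : size rs = d.
  apply: succn_inj; rewrite -(@size_prod_XsubC _ _ rs id) -(size_scale _ (lt0r_neq0 he)).
  by rewrite -hE; apply: (size_line_topE _ (has_top_refl ht.1)); rewrite gt_eqF.
rewrite coefZ mulr_gt0 // coef_prod_neg_roots_gt0 ?size_map ?srs //.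
rewrite all_map; apply: sub_all rs0 => r /= r0; lra.
Qed.

Lemma imJ_line_cone d e v F h :
  has_top d F h -> h.@[e] != 0 -> in_cone h e v ->
  (forall x, real_rooted (line F x e)) ->
  forall x z, 0 < Im z -> imJ (line (Dder v F) x e) (line F x e) z <= 0.
Proof.
move=> ht; rewrite neq_lt => /orP[he|he] hv hrr x z hz; last first.
  exact: imJ_line_cone_pos ht he hv hrr _ _ hz.
have N1 : (-1 : R) *: h = - h by rewrite scaleN1r.
have := @imJ_line_cone_pos d e v (-1 *: F) (-1 *: h) _ _ _ _ x z hz.
rewrite DderZ !lineZ imJZl imJZr mulrA mulrNN mulr1 mul1r; apply.
- split; first exact: dhomogZ ht.1.
  by rewrite -scalerBr; apply: msizeZ_leq ht.2.
- by rewrite mevalZ mulN1r oppr_gt0.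
- by case: hv => rs rs0 hE; exists rs => //; rewrite lineZ hE mevalZ scalerA.
- by move=> y; rewrite lineZ; apply: real_rootedZ.
Qed.

Lemma has_top_sub_sum d F h (I : finType) (p : I -> R) (w : I -> 'I_n -> R) (y : R) :
  has_top d F h -> has_top d (F - y *: \sum_i p i *: Dder (w i) F) h.
Proof.
move=> ht; rewrite -scaleNr; apply: has_topD => //; apply: msizeZ_leq.
elim/big_ind: _ => [|F1 F2|i _]; first by rewrite msize0.
  exact: msizeD_leq.
by apply: msizeZ_leq; apply: has_top_Dder_msize ht.
Qed.

Lemma real_rooted_sub_cone_sum d e F h (I : finType) (p : I -> R)
    (w : I -> 'I_n -> R) (y : R) :
  has_top d F h -> h.@[e] != 0 -> (forall i, in_cone h e (w i)) ->
  (forall i, 0 <= p i) -> (forall x, real_rooted (line F x e)) ->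
  forall x, real_rooted (line (F - y *: \sum_i p i *: Dder (w i) F) x e).
Proof.
move=> ht he hw hp hrr x.
have ht' := has_top_sub_sum p w y ht.
have sF : size (line F x e) = d.+1 by apply: (size_line_topE _ ht).
have sF' := size_line_topE x ht' he.
case: (posnP d) => [d0|d0].
  by apply: real_rooted_size1; rewrite sF' d0.
have sq : (size ((- y) *: line (Dder e F) x e)%R <= d)%N.
  apply: leq_trans (size_scale_leq _ _) _.
  by apply: size_line; apply: has_top_Dder_msize ht.
(* At a nonreal zero of [F - y G], [imJ] of [G] and [F] vanishes, but the cone inequality for it is
   weak. Adding [t D_e F] to [G] makes it strict; the perturbation has lower degree, so it can be
   removed in the limit. *)
apply: (@real_rooted_limit _ _ ((- y) *: line (Dder e F) x e)).
- by rewrite sF' (leq_trans sq).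
- by rewrite sF' /= nth_default // mulr0.
move=> t t0; apply: cev_neq0_real_rooted => z hz; apply/eqP => h0.
set G := \sum_i _ in h0 ht'; set P := line F x e; set g := line G x e.
have PP : imJ P^`() P z < 0 by apply: imJ_deriv_lt0; rewrite ?/P ?sF.
have gP : imJ g P z <= 0.
  rewrite /g /G /line raddf_sum /=.
  elim/big_ind: _ => [|f1 f2 h1 h2|i _].
  - by rewrite -(scale0r P) imJZl mul0r.
  - by rewrite imJDl; lra.
  - rewrite -/(line _ x e) lineZ imJZl mulr_ge0_le0 //.
    exact: imJ_line_cone ht he (hw i) hrr _ _ hz.
have : imJ (P - y *: (g + t *: P^`())) (g + t *: P^`()) z = 0.
  have -> : P - y *: (g + t *: P^`()) =
      line (F - y *: G) x e + t *: ((- y) *: line (Dder e F) x e).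
    rewrite lineB lineZ -deriv_line -/P -/g scalerDr.
    by rewrite opprD addrA !scalerA mulrN scaleNr [t * y]mulrC.
  by rewrite /imJ h0 /= !mul0r subrr.
rewrite -scaleNr imJDl imJZl imJpp mulr0 addr0 imJC imJDl imJZl => /eqP.
rewrite oppr_eq0 => /eqP h1.
have : t * imJ P^`() P z < 0 by rewrite pmulr_rlt0.
lra.
Qed.

End Cone.

(** * Directions of rank zero and one *)

Section RankOne.
Variables (R : rcfType) (n : nat).
Implicit Types (F G h : {mpoly R[n]}) (e u v x : 'I_n -> R).
Local Notation Im := (@complex.Im R).
Local Notation Re := (@complex.Re R).

Lemma meval_Dder_eq G h x y v :
  (forall t, G.@[fun i => x i + t * v i] = h.@[fun i => y i + t * v i]) ->
  (Dder v G).@[x] = (Dder v h).@[y].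
Proof.
move=> H; rewrite -!(horner_line0 _ _ v) -!deriv_line; congr (_^`().[_]).
by apply: poly_ext_pos => t _; rewrite !horner_line.
Qed.

Lemma prod_nseq0 k : \prod_(r <- nseq k (0 : R)) ('X - r%:P) = 'X^k.
Proof. by rewrite big_nseq subr0 iter_mulr_1. Qed.

(** The hypothesis says that [q(z) / p(z)] is real; [y] is this quotient. *)
Lemma cev_sub_scale_eq0 (p q : {poly R}) z : imJ p q z = 0 -> cev p z != 0 ->
  exists y : R, cev (q - y *: p) z = 0.
Proof.
rewrite /imJ => h hp.
exists ((Re (cev q z) * Re (cev p z) + Im (cev q z) * Im (cev p z)) / csqr (cev p z)).
have : csqr (cev p z) != 0 by rewrite gt_eqF // csqr_gt0.
rewrite cevD -scaleNr cevZ /csqr; move: h {hp}.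
case: (cev p z) => a b; case: (cev q z) => c d /= h hn.
apply/eqP; rewrite eq_complex /= !mul0r addr0 subr0; apply/andP; split; apply/eqP.
  have -> : c + - ((c * a + d * b) / (a ^+ 2 + b ^+ 2)) * a =
     b * (b * c - a * d) / (a ^+ 2 + b ^+ 2) by field.
  by rewrite h mulr0 mul0r.
have -> : d + - ((c * a + d * b) / (a ^+ 2 + b ^+ 2)) * b =
   - (a * (b * c - a * d)) / (a ^+ 2 + b ^+ 2) by field.
by rewrite h mulr0 oppr0 mul0r.
Qed.

Lemma in_cone_pure_top d e v h :
  line h v e = h.@[e] *: 'X^d -> in_cone h e v.
Proof.
move=> hE; exists (nseq d 0); first by rewrite all_nseq lexx orbT.
by rewrite prod_nseq0.
Qed.

Lemma line_oppr d h v e : h \is d.-homog ->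
  line h (fun i => - v i) e = (-1) ^+ d *: (line h v e \Po (- 'X)).
Proof.
move=> hh; apply: poly_ext_pos => t _.
rewrite hornerZ horner_comp hornerN hornerX !horner_line -meval_dhomogZ //.
by apply: meval_eq => i; ring.
Qed.

(** Both [v] and [- v] lie in the cone, so [D_v F / F] is real throughout the upper half-plane. If
    [D_v F] were nonzero at such a [z], some real [y] would make [F - y D_v F] vanish at [z],
    against its real-rootedness. So [D_v F] vanishes on the half-plane, hence identically. *)
Lemma Dder_eq0_pure_top d e v F h :
  has_top d F h -> h.@[e] != 0 -> line h v e = h.@[e] *: 'X^d ->
  (forall x, real_rooted (line F x e)) -> forall x, (Dder v F).@[x] = 0.
Proof.
move=> ht he hv hrr x; rewrite -(horner_line0 _ _ e).
suff -> : line (Dder v F) x e = 0 by rewrite horner0.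
have hv' : line h (fun i => - v i) e = h.@[e] *: 'X^d.
  rewrite (line_oppr v e ht.1); apply: poly_ext_pos => t _.
  rewrite hornerZ horner_comp hv !hornerZ !hornerXn hornerN hornerX.
  by rewrite mulrCA -exprMn mulN1r opprK.
apply: cev_eq0 => z hz; apply/eqP/negPn/negP => hn.
set A := line _ _ _ in hn *; set P := line F x e.
have h1 : imJ A P z <= 0 := imJ_line_cone ht he (in_cone_pure_top hv) hrr x hz.
have h2 : 0 <= imJ A P z.
  have := imJ_line_cone ht he (in_cone_pure_top hv') hrr x hz.
  have -> : Dder (fun i => - v i) F = - Dder v F.
    by rewrite /Dder -sumrN; apply: eq_bigr => i _; rewrite scaleNr.
  by rewrite -scaleN1r lineZ scaleN1r imJNl oppr_le0.
have [|y] := @cev_sub_scale_eq0 A P z _ hn; first by apply/eqP; rewrite eq_le h1 h2.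
have := @real_rooted_sub_cone_sum R n d e F h unit (fun _ => 1) (fun _ => v) y ht he
   (fun _ => in_cone_pure_top hv) (fun _ => ler01) hrr x.
have := size_line_topE x (@has_top_sub_sum R n d F h unit (fun _ => 1) (fun _ => v) y ht) he.
rewrite (big_pred1 tt) => [|[]//]; rewrite scale1r lineB lineZ -/A -/P => hs hr h0.
have := real_rooted_cev_neq0 hr _ (negbT (gt_eqF hz)).
by rewrite h0 eqxx -size_poly_eq0 hs => /(_ isT).
Qed.

(** By homogeneity [(D_v h)(v + t e) = c t^d]. If [c] is nonzero, [v] has rank zero for [D_v h],
    which is real-rooted along [e], so the rank-zero case applies to [D_v h]. If [l = 0], it applies
    to [h] already. *)
Lemma Dder2_eq0_rank1 d e v h (l : R) :
  h \is d.+1.-homog -> h.@[e] != 0 -> l <= 0 ->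
  line h v e = h.@[e] *: (('X - l%:P) * 'X^d) ->
  (forall x, real_rooted (line h x e)) ->
  forall x, (Dder v (Dder v h)).@[x] = 0.
Proof.
move=> hh he l0 hE hrr.
have ht := has_top_refl hh.
have [l00|ln0] := eqVneq l 0.
  have D0 y : (Dder v h).@[y] = 0.
    by apply: (Dder_eq0_pure_top ht he _ hrr); rewrite hE l00 subr0 -exprS.
  move=> x; rewrite (@meval_Dder_eq (Dder v h) 0 x x) ?/Dder ?raddf0.
    by rewrite big1 ?meval0 // => i _; rewrite mderiv0 scaler0.
  by move=> t; rewrite D0 meval0.
have cv : in_cone h e v.
  exists (l :: nseq d 0); first by rewrite /= l0 all_nseq lexx orbT.
  by rewrite hE big_cons prod_nseq0.
pose c := - (l * h.@[e]).
have hE' : line (Dder v h) v e = c *: 'X^d.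
  apply: poly_ext_pos => t _.
  have -> : (line (Dder v h) v e).[t] = (line (Dder v h) (fun i => t * e i) v).[1].
    by rewrite !horner_line; apply: meval_eq => i; ring.
  (* [h(t e + s v) = s^(d+1) h((t / s) e + v)]; testing at [s > 0] makes the division legitimate. *)
  have LE : line h (fun i => t * e i) v = (h.@[e] * t ^+ d) *: (t%:P - l *: 'X).
    apply: poly_ext_pos => s s0.
    have -> : (line h (fun i => t * e i) v).[s] = s ^+ d.+1 * (line h v e).[t / s].
      rewrite !horner_line -meval_dhomogZ //; apply: meval_eq => i.
      by field; rewrite gt_eqF.
    rewrite hE !(hornerZ, hornerM, hornerD, hornerN, hornerX, hornerC, hornerXn).
    by rewrite expr_div_n exprS; field; rewrite expf_neq0 gt_eqF.
  rewrite -deriv_line LE derivZ derivB derivC derivZ derivX sub0r.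
  by rewrite !(hornerZ, hornerN, hornerC, hornerXn) /c; ring.
have ht' := has_top_Dder v ht.
have cE : (Dder v h).@[e] = c.
  by rewrite -(coef_line_dhomog v e ht'.1) hE' coefZ coefXn eqxx mulr1.
have c0 : c != 0 by rewrite oppr_eq0 mulf_neq0.
apply: (Dder_eq0_pure_top ht' (e := e)); rewrite ?cE // => x.
have hte := has_top_Dder e ht.
have sA : size (line (Dder v h) x e) = d.+1 by apply: (size_line_topE x ht'); rewrite cE.
(* Adding [t D_e h] makes the weak cone inequality strict. The coefficients of degree [d] are [c]
   and [(d + 1) h(e)], with product [- (d + 1) l h(e)^2 >= 0], as the limit requires. *)
apply: (@real_rooted_limit _ _ (line (Dder e h) x e)).
- by rewrite sA (size_line_top x e hte).
- rewrite lead_coefE sA /= (coef_line_top x e ht') cE -deriv_line coef_deriv.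
  rewrite (coef_line_top x e ht) mulrnAr mulrn_wge0 // /c mulNr oppr_ge0.
  by rewrite -mulrA -expr2 mulr_le0_ge0 ?sqr_ge0.
move=> t t0; apply: cev_neq0_real_rooted => z hz; apply/eqP => h0.
have : imJ (line (Dder v h) x e + t *: line (Dder e h) x e) (line h x e) z < 0.
  rewrite imJDl imJZl.
  have h1 := imJ_line_cone ht he cv hrr x hz.
  have h2 : imJ (line (Dder e h) x e) (line h x e) z < 0.
    by rewrite -deriv_line; apply: imJ_deriv_lt0; rewrite ?(size_line_topE x ht).
  have h3 : t * imJ (line (Dder e h) x e) (line h x e) z < 0 by rewrite pmulr_rlt0.
  lra.
by rewrite /imJ h0 /= !mul0r subrr ltxx.
Qed.

Lemma meval_affine v h : (forall x, (Dder v (Dder v h)).@[x] = 0) ->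
  forall x t, h.@[fun i => x i + t * v i] = h.@[x] + t * (Dder v h).@[x].
Proof.
move=> h0 x t; rewrite -horner_line -(horner_line0 h x v) -(horner_line0 _ x v).
rewrite -deriv_line; set f := line h x v.
have f2 : f^`()^`() = 0.
  by apply: poly_ext_pos => s _; rewrite !deriv_line horner_line h0 horner0.
have sf : (size f <= 2)%N.
  apply/leq_sizeP => -[|[|j]] // _; have /polyP/(_ j) := f2.
  by rewrite !coef_deriv coef0 -mulrnA => /eqP; rewrite mulrn_eq0 /= => /eqP.
have -> : f = (f`_0)%:P + f`_1 *: 'X.
  apply/polyP => -[|[|j]]; rewrite coefD coefC coefZ coefX /= ?mulr0 ?mulr1 ?addr0 ?add0r //.
  by rewrite nth_default // (leq_trans sf).
rewrite derivD derivC derivZ derivX !(hornerD, hornerZ, hornerC, hornerX); ring.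
Qed.

Lemma count_neq0_prod (r : R) rs : (count (fun a : R => a != 0)%R (r :: rs) <= 1)%N ->
  exists2 l : R, l \in r :: rs & \prod_(a <- r :: rs) ('X - a%:P) = ('X - l%:P) * 'X^(size rs).
Proof.
have pure s : count (fun a : R => a != 0) s = 0%N -> \prod_(a <- s) ('X - a%:P) = 'X^(size s).
  elim: s => [|a s IH] /=; first by rewrite big_nil.
  by have [->|//] := eqVneq a 0; rewrite add0n big_cons subr0 exprS => /IH ->.
elim: rs r => [|b rs IH] r; first by exists r; rewrite ?mem_head // big_seq1 mulr1.
have [->|r0] := eqVneq r 0; last first.
  rewrite [count _ _]/= r0 add1n ltnS leqn0 => /eqP h; have E := pure (b :: rs) h.
  by exists r; rewrite ?mem_head // big_cons E.
rewrite [count _ _]/= eqxx add0n => /IH[l lin E]; exists l; first by rewrite inE lin orbT.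
by rewrite big_cons E subr0 mulrCA -exprS.
Qed.

End RankOne.

(** * Products of operators and their expectation *)

Section Bracket.
Variables (R : rcfType) (n : nat).
Implicit Types (F h : {mpoly R[n]}).

Lemma sum_dffun_prod m (S : 'I_m -> finType) (p : forall i, S i -> R) :
  \sum_(s : {dffun forall i, S i}) \prod_i p i (s i) = \prod_i \sum_a p i a.
Proof.
rewrite (reindex (@dffun_of_fprod _ S)); last exact/onW_bij/dffun_of_fprod_bij.
transitivity (\sum_(t : fprod S) \prod_(i in 'I_m) [ffun a => p i a] (t i)).
  by apply: eq_bigr => t _; apply: eq_bigr => i _; rewrite !ffunE.
rewrite big_fprod -(bigA_distr_big_dep _ (fun i j => untag 0 [ffun a => p i a] j)).
apply: eq_bigr => i _; rewrite big_tag; apply: eq_bigr => j _.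
by rewrite /untag; case: eqP => // E; rewrite ffunE.
Qed.

(** The variables [y_j] are already real numbers here, so top forms concern the [x] variables
    alone. *)
Definition bracket_ops m (y : 'I_m -> R) (v : 'I_m -> 'I_n -> R) F (js : seq 'I_m) :=
  foldr (fun j q => q - y j *: Dder (v j) q) F js.

Lemma has_top_bracket_ops m y (v : 'I_m -> 'I_n -> R) d F h js :
  has_top d F h -> has_top d (bracket_ops y v F js) h.
Proof.
move=> ht; elim: js => //= j js IH; rewrite -scaleNr; apply: has_topD => //.
by apply: msizeZ_leq; apply: has_top_Dder_msize IH.
Qed.

Definition mean_ops m (S : 'I_m -> finType) (y : 'I_m -> R)
    (v : forall i, S i -> 'I_n -> R) (p : forall i, S i -> R) F (js : seq 'I_m) :=
  foldr (fun j q => q - y j *: \sum_(a : S j) p j a *: Dder (v j a) q) F js.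

Lemma has_top_mean_ops m (S : 'I_m -> finType) y (v : forall i, S i -> 'I_n -> R)
    p d F h js : has_top d F h -> has_top d (mean_ops y v p F js) h.
Proof. by move=> ht; elim: js => //= j js IH; apply: has_top_sub_sum. Qed.

Lemma real_rooted_mean_ops m (S : 'I_m -> finType) y (v : forall i, S i -> 'I_n -> R)
    p d e F h js :
  has_top d F h -> h.@[e] != 0 -> (forall i a, in_cone h e (v i a)) ->
  (forall i a, 0 <= p i a) -> (forall x, real_rooted (line F x e)) ->
  forall x, real_rooted (line (mean_ops y v p F js) x e).
Proof.
move=> ht he hv hp hrr; elim: js => //= j js IH x.
apply: (@real_rooted_sub_cone_sum _ _ d _ _ h) => //; exact: has_top_mean_ops.
Qed.

Lemma eq_mean_ops m (S : 'I_m -> finType) y (v : forall i, S i -> 'I_n -> R)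
    p q F js :
  (forall i, i \in js -> q i =1 p i) -> mean_ops y v q F js = mean_ops y v p F js.
Proof.
elim: js => [|j js IH hq]; first by [].
rewrite /mean_ops /= -/(mean_ops y v q F js) -/(mean_ops y v p F js).
rewrite IH => [|i ijs]; last by apply: hq; rewrite inE ijs orbT.
set G := mean_ops y v p F js.
have -> : \sum_a q j a *: Dder (v j a) G = \sum_a p j a *: Dder (v j a) G.
  by apply: eq_bigr => a _; rewrite hq // mem_head.
by [].
Qed.

(* The weights outside [js] are left unnormalised, so that the factor [v_j(s_j)]
   produced by [Dder] can be absorbed into the weight of the index [j]. *)
Lemma sum_bracket_ops m (S : 'I_m -> finType) (y : 'I_m -> R)
    (v : forall i, S i -> 'I_n -> R) F js (p : forall i, S i -> R) :
  uniq js -> (forall i, i \in js -> \sum_a p i a = 1) ->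
  \sum_(s : {dffun forall i, S i}) (\prod_i p i (s i)) *: bracket_ops y (fun i => v i (s i)) F js
  = (\prod_(i | i \notin js) \sum_a p i a) *: mean_ops y v p F js.
Proof.
elim: js p => [|j js IH] p /=.
  by move=> _ _; rewrite -scaler_suml sum_dffun_prod; congr (_ *: _); apply: eq_bigl.
move=> /andP[jn ujs] hp.
have hp' i : i \in js -> \sum_a p i a = 1 by move=> ijs; apply: hp; rewrite inE ijs orbT.
set B := mean_ops y v p F js; set K := \prod_(i | _) _.
have KE (q : forall i, S i -> R) : (forall i, i != j -> q i =1 p i) ->
    \prod_(i | i \notin js) \sum_a q i a = (\sum_a q j a) * K.
  move=> hq; rewrite (bigD1 j) //=; congr (_ * _).
  apply: eq_big => [i|i /andP[_ ij]]; first by rewrite inE negb_or andbC.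
  by apply: eq_bigr => a _; rewrite hq.
under eq_bigr do rewrite scalerBr.
rewrite sumrB IH // KE // hp ?mem_head // mul1r -/B [RHS]scalerBr; congr (_ - _).
(* The weight at [j] absorbs the [k]-th coordinate of [v_j(s_j)]. As [j] is not in [js], the
   averaged operators are unchanged. *)
pose q k i (a : S i) := if i == j then p i a * v i a k else p i a.
have qB k : mean_ops y v (q k) F js = B.
  apply: eq_mean_ops => i ijs a; rewrite /q; case: eqP => // ij.
  by rewrite -ij ijs in jn.
have IHk k : \sum_(s : {dffun forall i, S i})
     (\prod_i p i (s i) * v j (s j) k) *: bracket_ops y (fun i => v i (s i)) F js =
   ((\sum_a p j a * v j a k) * K) *: B.
  have := IH (q k) ujs; rewrite qB KE => [|i /negPf ij a]; last by rewrite /q ij.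
  rewrite {3}/q eqxx => <- => [|i ijs]; last first.
    rewrite -(hp' i ijs); apply: eq_bigr => a _; rewrite /q.
    by case: eqP => // ij; rewrite -ij ijs in jn.
  apply: eq_bigr => s _; congr (_ *: _).
  rewrite (bigD1 j) //= [in RHS](bigD1 j) //= {1}/q eqxx mulrAC; congr (_ * _).
  by apply: eq_bigr => i /negPf ij; rewrite /q ij.
transitivity (y j *: \sum_k mderiv k (((\sum_a p j a * v j a k) * K) *: B)).
  under [in RHS]eq_bigr do rewrite -IHk raddf_sum /=.
  rewrite exchange_big /= scaler_sumr; apply: eq_bigr => s _.
  rewrite scalerA mulrC -scalerA; congr (_ *: _); rewrite /Dder scaler_sumr.
  by apply: eq_bigr => k _; rewrite mderivZ scalerA.
rewrite scalerA mulrC -scalerA; congr (_ *: _).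
rewrite scaler_sumr /Dder.
under [RHS]eq_bigr do rewrite !scaler_sumr.
rewrite exchange_big /=; apply: eq_bigr => k _.
rewrite mderivZ mulrC -scalerA scaler_suml scaler_sumr; apply: eq_bigr => a _.
by rewrite !scalerA mulrA.
Qed.

(** When [D_v D_v h = 0], Taylor's formula makes [1 - a D_v] translation by [- a v] on [h], and also
    on the translates of [h] produced by the other factors. *)
Lemma meval_bracket_ops_rank1 m (alpha : 'I_m -> R) (v : 'I_m -> 'I_n -> R) h js x :
  (forall j x, (Dder (v j) (Dder (v j) h)).@[x] = 0) ->
  (bracket_ops alpha v h js).@[x] = h.@[fun k => x k - \sum_(j <- js) alpha j * v j k].
Proof.
move=> h0; elim: js x => [|j js IH] x /=.
  by apply: meval_eq => k; rewrite big_nil subr0.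
rewrite mevalB mevalZ IH.
rewrite (@meval_Dder_eq _ _ _ h x (fun k => x k - \sum_(j <- js) alpha j * v j k)); last first.
  by move=> t; rewrite IH; apply: meval_eq => k; ring.
rewrite -mulNr -meval_affine //; apply: meval_eq => k.
by rewrite big_cons; ring.
Qed.

End Bracket.

(** * Specialising the variables [y_j] in the bracket *)

Section BracketEvaluation.
Variables (R : rcfType) (n m : nat) (e : 'rV[R]_n) (w : 'rV[R]_(n + m)).

(** Sets each [y_j] to its coordinate in [w]. Derivations along [extv] do not involve the [y_j], so
    the substitution commutes with them. *)
Let subst_y : {mpoly R[n + m]} -> {mpoly R[n]} :=
  mmap (@mpolyC n R) (fun k => match split k with inl i => 'X_i | inr _ => (w 0 k)%:MP end).

Lemma split_lshift (i : 'I_n) : split (lshift m i) = inl i.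
Proof. exact: (unsplitK (inl i)). Qed.

Lemma split_rshift (j : 'I_m) : split (rshift n j) = inr j.
Proof. exact: (unsplitK (inr j)). Qed.

Lemma evalNM_line_subst P : evalNM_line P e w =
  line (subst_y P) (fun i => w 0 (lshift m i)) (fun i => e 0 i).
Proof.
rewrite /evalNM_line /subst_y; elim/mpoly_ring_ind: P => [c|k|F G IF IG|F G IF IG].
- by rewrite !mmapC lineC.
- rewrite !mmapX !mmap1U; case: (split_ordP k) => i ->.
    by rewrite lineX.
  by rewrite lineC.
- by rewrite !mmapD lineD IF IG.
- by rewrite !rmorphM /= lineM IF IG.
Qed.

Lemma subst_y_hlift (h : {mpoly R[n]}) : subst_y (hlift m h) = h.
Proof.
rewrite /hlift /subst_y -[fun c => c%:MP]/(@mpolyC (n + m) R).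
elim/mpoly_ring_ind: h => [c|k|F G IF IG|F G IF IG].
- by rewrite !mmapC.
- by rewrite mmapX mmap1U mmapX mmap1U split_lshift.
- by rewrite !mmapD IF IG.
- by rewrite !rmorphM /= IF IG.
Qed.

Lemma subst_y_Dder (v : 'rV[R]_n) P :
  subst_y (Dder (@extv R n m v) P) = Dder (fun i => v 0 i) (subst_y P).
Proof.
rewrite /subst_y; elim/mpoly_ring_ind: P => [c|k|F G IF IG|F G IF IG].
- by rewrite DderC mmap0 mmapC DderC.
- rewrite DderX mmapC mmapX mmap1U /extv; case: (split_ordP k) => i _.
    by rewrite DderX.
  by rewrite DderC.
- by rewrite DderD !mmapD DderD IF IG.
- by rewrite DderM mmapD !rmorphM /= DderM IF IG.
Qed.

Lemma evalNM_line_hbracket h (vs : 'I_m -> 'rV[R]_n) :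
  evalNM_line (hbracket h vs) e w =
  line (bracket_ops (fun j => w 0 (rshift n j)) (fun j i => vs j 0 i) h (enum 'I_m))
    (fun i => w 0 (lshift m i)) (fun i => e 0 i).
Proof.
rewrite evalNM_line_subst; congr line; rewrite /hbracket.
elim: (enum 'I_m) => [|j js IH] /=; first exact: subst_y_hlift.
have -> P1 P2 : subst_y (P1 - P2) = subst_y P1 - subst_y P2 by exact: mmapB.
have -> P1 P2 : subst_y (P1 * P2) = subst_y P1 * subst_y P2 by exact: rmorphM.
rewrite subst_y_Dder IH -mul_mpolyC; congr (_ - _ * _).
by rewrite /subst_y mmapX mmap1U split_rshift.
Qed.

End BracketEvaluation.

(** * Hyperbolicity, eigenvalues and rank in terms of lines *)

Lemma hline_line (R : rcfType) n (h : {mpoly R[n]}) (e x : 'rV[R]_n) :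
  hline h e x = line h (fun i => - x 0 i) (fun i => e 0 i).
Proof.
by apply: eq_bigr => k _; congr (_ * _); apply: eq_bigr => i _; rewrite polyCN.
Qed.

Lemma real_rooted_line_hyperbolic (R : rcfType) n (h : {mpoly R[n]}) (e : 'rV[R]_n) x :
  hyperbolic h e -> real_rooted (line h x (fun i => e 0 i)).
Proof.
move=> [_ /(_ (\row_i (- x i)))]; rewrite hline_line.
congr real_rooted; apply: poly_ext_pos => t _; rewrite !horner_line.
by apply: meval_eq => i; rewrite mxE opprK.
Qed.

Lemma eigenvalues_line (R : rcfType) n d (h : {mpoly R[n]}) (e v : 'rV[R]_n) rs :
  h \is d.-homog -> h.@[fun i => e 0 i] != 0 -> eigenvalues h e v rs ->
  size rs = d /\
  line h (fun i => v 0 i) (fun i => e 0 i) =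
    h.@[fun i => e 0 i] *: \prod_(r <- [seq - r | r <- rs]) ('X - r%:P).
Proof.
move=> hh he; rewrite /eigenvalues hline_line => hE.
have srs : size rs = d.
  apply: succn_inj; rewrite -(@size_prod_XsubC _ _ rs id) -(size_scale _ he) -hE.
  by rewrite (size_line_topE _ (has_top_refl hh) he).
split=> //.
have -> : line h (fun i => v 0 i) (fun i => e 0 i) =
    line h (fun i => - - v 0 i) (fun i => e 0 i).
  by apply: poly_ext_pos => t _; rewrite !horner_line; apply: meval_eq => i; rewrite opprK.
rewrite (line_oppr _ _ hh) hE; apply: poly_ext_pos => t _.
rewrite !(hornerZ, horner_comp, hornerN, hornerX) mulrCA !horner_prod big_map; congr (_ * _).
rewrite -srs; elim: rs {hE srs} => [|r rs IH]; first by rewrite !big_nil mulr1.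
rewrite !big_cons -IH /= exprS !hornerXsubC; ring.
Qed.

Lemma in_cone_Lambda_plus (R : rcfType) n d (h : {mpoly R[n]}) (e v : 'rV[R]_n) :
  h \is d.-homog -> h.@[fun i => e 0 i] != 0 -> in_Lambda_plus h e v ->
  in_cone h (fun i => e 0 i) (fun i => v 0 i).
Proof.
move=> hh he [rs [/(eigenvalues_line hh he)[_ E] rs0]].
exists [seq - r | r <- rs] => //; rewrite all_map.
by apply: sub_all rs0 => r /=; rewrite oppr_le0.
Qed.

Lemma Dder2_eq0_rank_le1 (R : rcfType) n d k (h : {mpoly R[n]}) (e v : 'rV[R]_n) :
  h \is d.-homog -> hyperbolic h e -> in_Lambda_plus h e v ->
  (k <= 1)%N -> rank_of h e v k ->
  forall x, (Dder (fun i => v 0 i) (Dder (fun i => v 0 i) h)).@[x] = 0.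
Proof.
move=> hh hyp hL k1 [rs [ev hk]]; have he := hyp.1.
have ht := has_top_refl hh.
have cv := in_cone_Lambda_plus hh he hL.
have [srs hE] := eigenvalues_line hh he ev.
case: d hh ht srs => [|d] hh ht srs x.
  rewrite -(horner_line0 _ x (fun i => e 0 i)).
  have /size_poly_leq0P -> : (size (line (Dder (fun i => v 0 i) (Dder (fun i => v 0 i) h)) x
      (fun i => e 0 i))%R <= 0)%N; last by rewrite horner0.
  by apply: size_line; apply: msize_DderS; apply: leqW; apply: has_top_Dder_msize ht.
case: rs {ev} srs hE hk => // r rs [srs] hE hk.
have [|l lin pE] := @count_neq0_prod R (- r) [seq - a | a <- rs].
  rewrite -[_ :: _]/[seq - a | a <- r :: rs] count_map (leq_trans _ k1) // -hk.
  by apply: sub_count => a /=; rewrite oppr_eq0.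
move: hE; rewrite map_cons pE size_map srs => hE.
apply: (Dder2_eq0_rank1 hh he _ hE).
  (* [l] is a zero of [h(v + t e)], so it occurs in the list of nonpositive zeros given by the
     cone. *)
  have [rs' rs0' hE'] := cv; move/allP: rs0'; apply.
  rewrite -root_prod_XsubC rootE; have := congr1 (horner^~ l) hE'.
  rewrite hE !hornerZ hornerM hornerXsubC subrr mul0r mulr0 => /esym/eqP.
  by rewrite mulf_eq0 (negPf he).
by move=> y; apply: real_rooted_line_hyperbolic hyp.
Qed.

(** * Compatibility of the two families *)

Lemma compatible_ext (R : rcfType) m (S : 'I_m -> finType) (f g : (forall i, S i) -> {poly R}) :
  (forall s, f s = g s) -> compatible f -> compatible g.
Proof.
move=> E [h1 h2]; split=> [s s'|p p0 p1]; first by rewrite -!E; apply: h1.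
by under eq_bigr do rewrite -E; apply: h2.
Qed.

Theorem theorem3p5 (R : rcfType) (n m d : nat) (h : {mpoly R[n]})
  (e : 'rV[R]_n) (V : 'I_m -> {fset 'rV[R]_n}) :
  h \is d.-homog ->
  hyperbolic h e ->
  (forall i (v : 'rV[R]_n), v \in V i -> in_Lambda_plus h e v) ->
  (forall w : 'rV[R]_(n + m),
     @compatible R m (fun i => V i : finType)
       (fun vs => evalNM_line (hbracket h (fun j => val (vs j))) e w))
  /\
  ((forall i (v : 'rV[R]_n), v \in V i -> exists2 k, (k <= 1)%N & rank_of h e v k) ->
   forall (w : 'rV[R]_n) (alpha : 'rV[R]_m),
     @compatible R m (fun i => V i : finType)
       (fun vs => hline_plus h e
          (fun k => w 0 k - \sum_(j < m) alpha 0 j * val (vs j) 0 k))).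
Proof.
move=> hh hyp hL; have he := hyp.1.
pose ev : 'I_n -> R := fun i => e 0 i.
have ht := has_top_refl hh.
have hrr x : real_rooted (line h x ev) := real_rooted_line_hyperbolic x hyp.
have main (w : 'rV[R]_(n + m)) : @compatible R m (fun i => V i : finType)
    (fun vs => evalNM_line (hbracket h (fun j => val (vs j))) e w).
  split=> [s s' _ _|p p0 p1].
    rewrite !evalNM_line_hbracket !lead_coefE.
    (* Every member has top form [h], hence degree [d] and leading coefficient [h(e)]. *)
    have T (s1 : forall i, V i) := has_top_bracket_ops (fun j => w 0 (rshift n j))
      (fun j i => val (s1 j) 0 i) (enum 'I_m) ht.
    by rewrite !(size_line_topE _ (T _) he) /= !(coef_line_top _ _ (T _)).
  pose v i (a : V i) : 'I_n -> R := fun k => val a 0 k.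
  have -> : \sum_(s : {dffun forall i, V i}) (\prod_(i < m) p i (s i)) *:
        evalNM_line (hbracket h (fun j => val (s j))) e w =
      line (mean_ops (fun j => w 0 (rshift n j)) v p h (enum 'I_m))
        (fun i => w 0 (lshift m i)) ev.
    have := @sum_bracket_ops R n m (fun i => V i : finType) (fun j => w 0 (rshift n j)) v h
      (enum 'I_m) p (enum_uniq _) (fun i _ => p1 i).
    (* All indices occur in [enum], so the product of leftover weights is empty. *)
    rewrite big_pred0 => [|i]; last by rewrite mem_enum.
    rewrite scale1r => <-; rewrite /line raddf_sum /=; apply: eq_bigr => s _.
    by rewrite evalNM_line_hbracket -lineZ.
  apply: (real_rooted_mean_ops _ _ ht he) => // i a.
  exact: (in_cone_Lambda_plus hh he (hL i _ (valP a))).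
split=> // hrk w alpha.
(* The second family is the first at the point [(w, alpha)], that is, with [y_j = alpha_j]. *)
apply: compatible_ext (main (row_mx w alpha)) => s.
rewrite evalNM_line_hbracket; apply: poly_ext_pos => t _.
rewrite horner_line meval_bracket_ops_rank1 => [|j]; last first.
  have [k k1 rk] := hrk j _ (valP (s j)).
  exact: (Dder2_eq0_rank_le1 hh hyp (hL j _ (valP (s j))) k1 rk).
rewrite -[hline_plus _ _ _]/(line h (fun k => w 0 k - \sum_(j < m) alpha 0 j * val (s j) 0 k) ev).
rewrite horner_line; apply: meval_eq => k.
rewrite row_mxEl big_enum /=; under eq_bigr do rewrite row_mxEr.
by rewrite /ev; ring.
Qed.
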